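(* Let $\nu_\infty>0$, $\nu>0$, $\delta>0$, $1<p<2$. Fix a Newton state $\boldsymbol U^m$ and a tangent $\mathcal T_\star^m:\mathbb{R}^{d\times d}_{\mathrm{sym}}\to\mathbb{R}^{d\times d}_{\mathrm{sym}}$ (a linear map depending on $x$ through the state). Assume there exists $\overline\eta\ge\nu_\infty>0$ such that, for a.e. $x\in\Omega$ and all $\boldsymbol B\in\mathbb{R}^{d\times d}_{\mathrm{sym}}$, $$\nu_\infty|\boldsymbol B|^2\le \mathcal T_\star^m(\boldsymbol B):\boldsymbol B,\qquad |\mathcal T_\star^m(\boldsymbol B)|+\bigl|D\boldsymbol S(\boldsymbol D\hat{\boldsymbol g}_D)(\boldsymbol B)\bigr|\le\overline\eta\,|\boldsymbol B|.\qquad(\ast)$$ Define, for $\boldsymbol v_h,\boldsymbol z_h\in\boldsymbol V_h$, $$\begin{aligned}a_\star^m(\boldsymbol v_h,\boldsymbol z_h)={}&\langle\mathcal T_\star^m(\boldsymbol D\boldsymbol v_h),\boldsymbol D\boldsymbol z_h\rangle-\langle\mathcal T_\star^m(\boldsymbol D\boldsymbol v_h)\boldsymbol n,\boldsymbol z_h\rangle_{\Gamma_D}-\langle\boldsymbol v_h,D\boldsymbol S(\boldsymbol D\hat{\boldsymbol g}_D)(\boldsymbol D\boldsymbol z_h)\,\boldsymbol n\rangle_{\Gamma_D}\\&+\gamma_1\langle h_{\Gamma_D}^{-1}\eta_D\boldsymbol v_h,\boldsymbol z_h\rangle_{\Gamma_D}+\gamma_2\langle h_{\Gamma_D}^{-1}(\boldsymbol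 v_h\cdot\boldsymbol n),\boldsymbol z_h\cdot\boldsymbol n\rangle_{\Gamma_D}.\end{aligned}$$ Then there exists $C_{\mathrm{tr}}>0$, depending only on shape regularity and on $\overline\eta/\nu_\infty$, such that for all $\boldsymbol v_h\in\boldsymbol V_h$, $$a_\star^m(\boldsymbol v_h,\boldsymbol v_h)\ge\frac{\nu_\infty}{2}\|\boldsymbol D\boldsymbol v_h\|_{L^2(\Omega)}^2+(\gamma_1\nu_\infty-C_{\mathrm{tr}})\|h_{\Gamma_D}^{-1/2}\boldsymbol v_h\|_{L^2(\Gamma_D)}^2+\gamma_2\|h_{\Gamma_D}^{-1/2}(\boldsymbol v_h\cdot\boldsymbol n)\|_{L^2(\Gamma_D)}^2.$$ In particular, if $\gamma_1\ge 2C_{\mathrm{tr}}/\nu_\infty$, then $a_\star^m$ is coercive on $\boldsymbol V_h$. The Dirichlet data $\boldsymbol g_D$ (possibly inhomogeneous) enter only through the fixed coefficients $\eta_D$ and $D\boldsymbol S(\boldsymbol D\hat{\boldsymbol g}_D)(\cdot)$, and the conclusion holds for any such data once the bounds $(\ast)$ hold. Moreover, for each of the three tangents $\mathcal T_{\mathrm{Pic}}^m$, $\mathcal T_{\mathrm{exN}}^m$, $\mathcal T_{\mathrm{modN}}^m$ given in the context, the bounds $(\ast)$ hold (for some $\overline\eta$) in the regime $\nu_\infty>0$.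
   Context: $\Omega\subset\mathbb R^d$, $d\in\{2,3\}$, is a bounded Lipschitz domain with boundary decomposition $\partial\Omega=\Gamma_D\cup\Gamma_N$, $\Gamma_D\cap\Gamma_N=\emptyset$, outer unit normal $\boldsymbol n$. $\langle\cdot,\cdot\rangle$ and $\langle\cdot,\cdot\rangle_{\Gamma_D}$ are the $L^2(\Omega)$ and $L^2(\Gamma_D)$ inner products. $\mathbb{R}^{d\times d}_{\mathrm{sym}}$ denotes symmetric matrices with Frobenius product $\boldsymbol A:\boldsymbol B$ and norm $|\boldsymbol A|$; $\boldsymbol D\boldsymbol v=\tfrac12(\nabla\boldsymbol v+(\nabla\boldsymbol v)^\top)$. Stress law: $\boldsymbol S(\boldsymbol A)=\eta(\boldsymbol A)\boldsymbol A$ with $\eta(\boldsymbol A)=\nu_\infty+\nu(\delta^2+|\boldsymbol A|^2)^{(p-2)/2}$. Its Fréchet derivative is $D\boldsymbol S(\boldsymbol A)(\boldsymbol B)=\eta(\boldsymbol A)\boldsymbol B+\nu(p-2)(\delta^2+|\boldsymbol A|^2)^{(p-4)/2}(\boldsymbol A:\boldsymbol B)\boldsymbol A$. Discretization: $\boldsymbol V_h\subset\boldsymbol H^1(\Omega)$ is a conforming piecewise polynomial velocity finite element space on a shape-regular mesh of $\Omega$. The velocity space belongs to an inf-sup stable pair $(\boldsymbol V_h,Q_h)$. Functions in $\boldsymbol V_h$ need not vanish on $\Gamma_D$. The discrete trace and Korn constants are assumed uniform under mesh refinement, up to the standard dependence on the (fixed) polynomial degree. $h_{\Gamma_D}$ is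 the local boundary mesh size on $\Gamma_D$; $\gamma_1,\gamma_2>0$ are penalty parameters. $\boldsymbol g_D$ is the Dirichlet trace on $\Gamma_D$ and $\hat{\boldsymbol g}_D$ is a fixed lifting of $\boldsymbol g_D$ to $\Omega$. $\eta_D=\eta(\boldsymbol D\hat{\boldsymbol g}_D)$ on $\Gamma_D$, so $\eta_D\ge\nu_\infty$. In the boundary terms, $\boldsymbol D\boldsymbol v_h$, $\mathcal T_\star^m$ and $D\boldsymbol S(\boldsymbol D\hat{\boldsymbol g}_D)$ are evaluated as traces from the adjacent mesh elements, where the coefficients are regarded as continuous up to the boundary. Coercive on $\boldsymbol V_h$ is understood with respect to the squared norm $\|\boldsymbol D\boldsymbol v_h\|_{L^2(\Omega)}^2+\|h_{\Gamma_D}^{-1/2}\boldsymbol v_h\|_{L^2(\Gamma_D)}^2$. Tangents: let $\boldsymbol v^m$ be the velocity component of $\boldsymbol U^m$, and set $\boldsymbol A^m=\boldsymbol D\boldsymbol v^m$, $\Delta^{m,2}=\delta^2+|\boldsymbol A^m|^2$, $\mu^m=\nu(\Delta^{m,2})^{(p-2)/2}$, $\eta^m=\nu_\infty+\mu^m$. Then (Picard) $\mathcal T_{\mathrm{Pic}}^m(\boldsymbol B)=\eta^m\boldsymbol B$; (exact Newton) $\mathcal T_{\mathrm{exN}}^m(\boldsymbol B)=\eta^m\boldsymbol B+(p-2)\frac{\mu^m}{\Delta^{m,2}}(\boldsymbol A^m:\boldsymbol B)\boldsymbol A^m$; (modified Newton) $\mathcal T_{\mathrm{modN}}^m(\boldsymbol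 B)=\eta^m\boldsymbol B+s^m(p-2)\frac{\mu^m}{\Delta^{m,2}}(\boldsymbol A^m:\boldsymbol B)\boldsymbol A^m$, where $\boldsymbol\sigma^m=\mu^m\boldsymbol A^m$, $s^m=\min\{1,\sigma_{\max}/|\boldsymbol\sigma^m|\}$ if $\boldsymbol\sigma^m\ne\boldsymbol 0$, $s^m=0$ if $\boldsymbol\sigma^m=\boldsymbol 0$, and $\sigma_{\max}>0$ is a fixed clipping threshold.
   Formalization: The constant is C_tr = ν_∞·c, where c depends only on shape regularity (through the assumed discrete trace constants, d and the degree) and on η̄/ν_∞; a C_tr without the factor ν_∞ fails when ν_∞, ν, η̄ and γ_2 are scaled together. *)

(* Defs.v *)
From HB Require Import structures.
From mathcomp Require Import all_boot all_order all_algebra.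
From mathcomp Require Import all_classical all_reals all_analysis.
From mathcomp Require Import measurable_realfun.
Set Implicit Arguments.
Unset Strict Implicit.
Unset Printing Implicit Defensive.
Import Order.TTheory GRing.Theory Num.Theory.
Import numFieldNormedType.Exports.

Local Open Scope classical_set_scope.
Local Open Scope ring_scope.

(* Points and vectors of R^d are row vectors. The library norm on them is the
   sup norm (same topology); Euclidean and Frobenius norms are defined here. *)

Section Euclidean.
Variables (R : realType) (d : nat).
Implicit Types (u v : 'rV[R]_d) (A B : 'M[R]_d).

Definition dot u v : R := \sum_i u 0 i * v 0 i.
Definition enorm u : R := Num.sqrt (dot u u).
Definition frob A B : R := \sum_i \sum_j A i j * B i j.
Definition fnorm A : R := Num.sqrt (frob A A).
Definition sym_mx A : Prop := A^T = A.
Definition mxv A u : 'rV[R]_d := u *m A^T. (* the column vector A u *)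

(* 0 for the empty set *)
Definition ediam (X : set 'rV[R]_d) : \bar R :=
  maxe 0%E (ereal_sup [set (enorm (x.1 - x.2))%:E | x in X `*` X]).
Definition diam (X : set 'rV[R]_d) : R := fine (ediam X).

End Euclidean.

Definition borel (R : realType) (d : nat) : Type :=
  g_sigma_algebraType (@open 'rV[R]_d).
HB.instance Definition _ (R : realType) (d : nat) :=
  Measurable.on (borel R d).

Section LebesgueMeasure.
Variable R : realType.

Definition row_of_tuple d (t : d.-tuple (measurableTypeR R)) : borel R d :=
  \row_i (tnth t i : R).

Lemma measurable_row_of_tuple d : measurable_fun setT (@row_of_tuple d).
Proof.
apply: (@measurability _ _ _ (borel R d) _ _ (@open 'rV[R]_d)) => //.
move=> _ [U oU <-]; rewrite setTI.
pose box (q : 'rV[rat]_d * nat) : set 'rV[R]_d :=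
  [set x | forall i, `|x 0 i - ratr (q.1 0 i)| < q.2.+1%:R^-1].
pose F (q : 'rV[rat]_d * nat) : set (d.-tuple (measurableTypeR R)) :=
  if `[< box q `<=` U >] then @row_of_tuple d @^-1` box q else set0.
have -> : @row_of_tuple d @^-1` U = \bigcup_q F q.
  apply/seteqP; split => [t Ut|t [q _]]; last first.
    by rewrite /F; case: asboolP => // qU /qU.
  have /nbhs_ballP[e /= e0 eU] : nbhs (row_of_tuple t : 'rV[R]_d) U.
    exact: open_nbhs_nbhs.
  have e20 : 0 < e / 2 by rewrite divr_gt0.
  have [n _ /(_ n (leqnn n)) /= ne] := near_infty_natSinv_lt (PosNum e20).
  have n0 : 0 < n.+1%:R^-1 :> R by [].
  have /choice[q qt] (i : 'I_d) : exists q : rat,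
      `|(tnth t i : R) - ratr q| < n.+1%:R^-1.
    have [||x [/= xt [q _ qx]]] :=
      @dense_rat R (ball (tnth t i : R) n.+1%:R^-1).
    - by exists (tnth t i); exact: ballxx.
    - exact: ball_open.
    - by exists q; rewrite qx.
  exists (\row_i q i, n) => //.
  rewrite /F; case: asboolP => [_|[]]; first by move=> i /=; rewrite !mxE.
  move=> y yq; apply: eU; split => // i j.
  rewrite (ord1 i) mxE /ball /=.
  have := qt j; have := yq j; rewrite /= mxE => h1 h2.
  rewrite (splitr e) -(subrKA (ratr (q j))).
  rewrite (le_lt_trans (ler_normD _ _))// ltrD//; first exact: lt_trans ne.
  by rewrite distrC; exact: lt_trans ne.
apply: countable_bigcupT_measurable => [|q]; first exact: countableP.
rewrite /F; case: asboolP => // _.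
have -> : @row_of_tuple d @^-1` box q =
    \big[setI/setT]_(i < d) ((@tnth _ (measurableTypeR R) ^~ i) @^-1`
      (ball (ratr (q.1 0 i) : R) q.2.+1%:R^-1)).
  apply/seteqP; split => [t qt|t].
    by apply: (big_ind (fun A : set _ => A t)) => // i _ /=;
       have := qt i; rewrite /ball/= mxE distrC.
  move=> + i; rewrite (bigD1 i)//= => -[+ _].
  by rewrite mxE /ball/= distrC.
apply: bigsetI_measurable => i _; rewrite -[X in measurable X]setTI.
apply: measurable_tnth => //; exact: measurable_ball.
Qed.

Lemma measurable_cons_tuple n :
  measurable_fun setT (fun x : n.-tuple (measurableTypeR R) * measurableTypeR R
    => [the n.+1.-tuple (measurableTypeR R) of x.2 :: x.1]).
Proof. by apply: measurable_cons. Qed.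

(* the d-fold product of the Lebesgue measure on R ... *)
Fixpoint leb_tuple d : {measure set (d.-tuple (measurableTypeR R)) -> \bar R} :=
  if d is n.+1 then
    measure_function_pushforward__canonical__measure_function_Measure
      (leb_tuple n \x (@lebesgue_measure R))%E (@measurable_cons_tuple n)
  else \d_ [tuple].

(* ... transported to R^d *)
Definition leb d : {measure set (borel R d) -> \bar R} :=
  measure_function_pushforward__canonical__measure_function_Measure
    (leb_tuple d) (@measurable_row_of_tuple d).

End LebesgueMeasure.

Section HausdorffMeasure.
Local Open Scope ereal_scope.
Variables (R : realType) (d s : nat).

(* volume of the s-dimensional Euclidean unit ball *)
Fixpoint unit_ball_vol (s : nat) : R :=
  match s with
  | 0 => 1%R
  | 1 => 2%R
  | n.+2 => (2 * pi / n.+2%:R * unit_ball_vol n)%R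
  end.

Definition hausdorff_gauge (e : R) (X : set (borel R d)) : \bar R :=
  if X == set0 then 0
  else if ediam X <= e%:E then (unit_ball_vol s / 2 ^+ s)%:E * ediam X ^+ s
  else +oo.

Lemma unit_ball_vol_ge0 n : (0 <= unit_ball_vol n)%R.
Proof.
suff: (0 <= unit_ball_vol n)%R && (0 <= unit_ball_vol n.+1)%R by case/andP.
elim: n => [|n /andP[h0 h1]]; first by rewrite /= ler01 ler0n.
rewrite h1 /= mulr_ge0// divr_ge0// mulr_ge0//; exact: pi_ge0.
Qed.

Lemma hausdorff_gauge0 e : hausdorff_gauge e set0 = 0.
Proof. by rewrite /hausdorff_gauge eqxx. Qed.

Lemma hausdorff_gauge_ge0 e X : 0 <= hausdorff_gauge e X.
Proof.
rewrite /hausdorff_gauge; case: ifP => // _; case: ifP => // _.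
rewrite mule_ge0//; first by rewrite lee_fin divr_ge0 ?unit_ball_vol_ge0.
by rewrite expe_ge0// /ediam le_max lexx.
Qed.

(* [mu_ext] takes the infimum over countable Borel covers; since a set and its
   closure have the same diameter, arbitrary covers give the same value. *)
Definition hausdorff (X : set (borel R d)) : \bar R :=
  ereal_sup [set mu_ext (hausdorff_gauge e) X | e in [set e : R | (0 < e)%R]].

Lemma mu_ext_le_hausdorff e X : (0 < e)%R ->
  mu_ext (hausdorff_gauge e) X <= hausdorff X.
Proof. by move=> e0; apply: ereal_sup_ubound; exists e. Qed.

Lemma hausdorff_ge0 X : 0 <= hausdorff X.
Proof.
apply: le_trans (mu_ext_le_hausdorff X ltr01).
exact: mu_ext_ge0 (hausdorff_gauge_ge0 1) _.
Qed.

Lemma hausdorff0 : hausdorff set0 = 0.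
Proof.
apply/eqP; rewrite eq_le hausdorff_ge0 andbT.
apply: ge_ereal_sup => _ [e _ <-].
by rewrite (mu_ext0 (hausdorff_gauge0 e) (hausdorff_gauge_ge0 e)).
Qed.

Lemma le_hausdorff : {homo hausdorff : X Y / X `<=` Y >-> X <= Y}.
Proof.
move=> X Y XY; apply: ge_ereal_sup => _ [e e0 <-].
apply: le_trans (mu_ext_le_hausdorff Y e0).
exact: le_mu_ext.
Qed.

Lemma hausdorff_sigma_subadditive : sigma_subadditive hausdorff.
Proof.
move=> F; apply: ge_ereal_sup => _ [e e0 <-].
apply: (le_trans (mu_ext_sigma_subadditive (hausdorff_gauge_ge0 e) F)).
apply: lee_nneseries => [i _ _|i _]; last exact: mu_ext_le_hausdorff.
exact: mu_ext_ge0 (hausdorff_gauge_ge0 e) _.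
Qed.

HB.instance Definition _ := isOuterMeasure.Build R _ hausdorff
  hausdorff0 hausdorff_ge0 le_hausdorff hausdorff_sigma_subadditive.

End HausdorffMeasure.

(* surface measure: the (d-1)-dimensional Hausdorff measure, on its
   Caratheodory sigma-algebra *)
Definition surface_outer (R : realType) (d : nat) :
  {outer_measure set (borel R d) -> \bar R} := hausdorff d.-1.
Definition surface_type (R : realType) (d : nat) :=
  caratheodory_type (surface_outer R d).
HB.instance Definition _ (R : realType) (d : nat) :=
  Measurable.on (surface_type R d).
Definition surf (R : realType) (d : nat) :
    {measure set (surface_type R d) -> \bar R} :=
  OuterMeasure_sort__canonical__measure_function_Measure (surface_outer R d).

Section Domains.
Variables (R : realType) (d : nat).
Local Notation E := 'rV[R]_d.

Definition bd (O : set E) : set E := closure O `\` O°.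

(* Near each boundary point O is the strict epigraph of a Lipschitz function in
   some orthonormal frame with last vector e; that function of the first d-1
   coordinates is written as a function on R^d invariant in the direction e. *)
Definition lipschitz_boundary (O : set E) : Prop :=
  forall x0, bd O x0 -> exists (e : E) (phi : E -> R) (L : R) (U : set E),
    [/\ enorm e = 1,
        forall x y, `|phi x - phi y| <= L * enorm (x - y),
        forall x t, phi (x + t *: e) = phi x,
        nbhs x0 U &
        forall x, U x -> (O x <-> phi x < dot x e)].

Definition lipschitz_domain (O : set E) : Prop :=
  [/\ open O, connected O, O !=set0,
      exists M, forall x, O x -> enorm x <= M & lipschitz_boundary O].

(* O is, to first order at x, the half-space {y | (y - x).n < 0} *)
Definition outer_unit_normal (O : set E) (x n : E) : Prop :=
  enorm n = 1 /\
  forall e, 0 < e -> exists2 r, 0 < r & forall y, enorm (y - x) < r ->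
    (e * enorm (y - x) < dot (y - x) n -> ~ O y) /\
    (dot (y - x) n < - (e * enorm (y - x)) -> O y).

Record domain := Domain {
  Omega : set E;
  GammaD : set E;
  GammaN : set E;
  normal : E -> E;
  Omega_lipschitz : lipschitz_domain Omega;
  bd_Omega : bd Omega = GammaD `|` GammaN;
  GammaDN : GammaD `&` GammaN = set0;
  measurable_GammaD : measurable (GammaD : set (surface_type R d));
  measurable_normal : forall i,
    measurable_fun (bd Omega : set (surface_type R d)) (fun x => normal x 0 i);
  normal_outer : {ae surf R d, forall x,
    bd Omega x -> outer_unit_normal Omega x (normal x)} }.

End Domains.

Section Calculus.
Variables (R : realType) (d : nat).
Local Notation E := 'rV[R]_d.
Local Notation M := 'M[R]_d.

Definition partial (j : 'I_d) (f : E -> R) : E -> R :=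
  fun x => 'D_(delta_mx 0 j) f x.

Definition grad (v : E -> E) (x : E) : M :=
  \matrix_(i, j) partial j (fun y => v y 0 i) x.

Definition sym_part (A : M) : M := 2^-1 *: (A + A^T).

Definition symgrad (v : E -> E) (x : E) : M := sym_part (grad v x).

Definition divergence (v : E -> E) (x : E) : R := \tr (grad v x).

Definition poly_fun (k : nat) (q : E -> R) : Prop :=
  exists c : {ffun 'I_d -> 'I_k.+1} -> R, forall x,
    q x = \sum_(a : {ffun 'I_d -> 'I_k.+1} | (\sum_j a j <= k)%N)
            c a * \prod_j x 0 j ^+ a j.

Definition smooth (f : E -> R) : Prop :=
  forall s : seq 'I_d, continuous (foldr partial f s) /\
    forall x j, derivable (foldr partial f s) x (delta_mx 0 j).

(* C_c^oo(O) *)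
Definition test_fun (O : set E) (f : E -> R) : Prop :=
  smooth f /\
  exists K, [/\ compact K, K `<=` O & forall x, ~ K x -> f x = 0].

Definition square_integrable (O : set E) (f : E -> R) : Prop :=
  measurable_fun (O : set (borel R d)) f /\
  (\int[leb R d]_(x in O) (f x ^+ 2)%:E < +oo)%E.

(* u is in H^1(O)^d, with weak gradient G *)
Definition H1_grad (O : set E) (u : E -> E) (G : E -> M) : Prop :=
  [/\ forall i, square_integrable O (fun x => u x 0 i),
      forall i j, square_integrable O (fun x => G x i j) &
      forall i j phi, test_fun O phi ->
        \int[leb R d]_(x in O) (u x 0 i * partial j phi x) =
        - \int[leb R d]_(x in O) (G x i j * phi x)].

End Calculus.

Section Mesh.
Variables (R : realType) (d : nat) (G : domain R d).
Local Notation E := 'rV[R]_d.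
Local Notation M := 'M[R]_d.

Record mesh := Mesh {
  nelt : nat;
  elt : 'I_nelt -> set E;
  elt_cover : closure (Omega G) = \bigcup_i elt i;
  elt_regular : forall i, elt i = closure (elt i)°;
  elt_lipschitz : forall i, lipschitz_domain (elt i)°;
  elt_disjoint : forall i j, i != j -> (elt i)° `&` (elt j)° = set0 }.

Variable Th : mesh.

(* An elementwise field: [f i] is the field on the closed element [elt i].  Its
   value at a point of Omega is taken from the element with that point in its
   interior, its trace on GammaD from the closed element containing that point;
   both are unique up to null sets. *)
Definition field (X : Type) := 'I_(nelt Th) -> E -> X.

Definition elt_at (x : E) : option 'I_(nelt Th) :=
  [pick i | `[< (elt i)° x >]].
Definition adj_elt (x : E) : option 'I_(nelt Th) := [pick i | `[< elt i x >]].

Definition glue (v : field E) (x : E) : E :=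
  if elt_at x is Some i then v i x else 0.

Definition int_Omega (f : field R) : R :=
  \int[leb R d]_(x in Omega G) (if elt_at x is Some i then f i x else 0).

Definition int_GammaD (f : field R) : R :=
  \int[surf R d]_(x in GammaD G) (if adj_elt x is Some i then f i x else 0).

(* mesh size; its value at the adjacent element is h_{GammaD} *)
Definition hsize (i : 'I_(nelt Th)) : R := diam (elt i).

Definition shape_regular (kappa : R) : Prop :=
  forall i, exists x r, [/\ 0 < r, forall y, enorm (y - x) < r -> elt i y &
    hsize i <= kappa * r].

Definition D_ (v : field E) : field M := fun i => symgrad (v i).

Definition normD2 (v : field E) : R :=
  int_Omega (fun i x => fnorm (D_ v i x) ^+ 2).
Definition normG2 (v : field E) : R :=
  int_GammaD (fun i x => (hsize i)^-1 * enorm (v i x) ^+ 2).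
Definition normGn2 (v : field E) : R :=
  int_GammaD (fun i x => (hsize i)^-1 * dot (v i x) (normal G x) ^+ 2).

Definition norm_grad2 (v : field E) : R :=
  int_Omega (fun i x => fnorm (grad (v i) x) ^+ 2).
Definition normH1 (v : field E) : R :=
  Num.sqrt (int_Omega (fun i x => enorm (v i x) ^+ 2) + norm_grad2 v).
Definition normL2 (q : field R) : R :=
  Num.sqrt (int_Omega (fun i x => q i x ^+ 2)).

Record fe_pair (k : nat) := FePair {
  Vh : set (field E);
  Qh : set (field R);
  Vh0 : Vh (fun _ _ => 0);
  Vh_lin : forall (a : R) v w, Vh v -> Vh w -> Vh (fun i x => a *: v i x + w i x);
  Vh_poly : forall v, Vh v -> forall i j, poly_fun k (fun x => v i x 0 j);
  Vh_H1 : forall v, Vh v -> exists W, H1_grad (Omega G) (glue v) W;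
  Qh0 : Qh (fun _ _ => 0);
  Qh_lin : forall (a : R) q r, Qh q -> Qh r -> Qh (fun i x => a * q i x + r i x);
  Qh_L2 : forall q, Qh q -> square_integrable (Omega G)
    (fun x => if elt_at x is Some i then q i x else 0);
  inf_sup : exists2 beta : R, 0 < beta & forall q, Qh q ->
    ((beta * normL2 q)%:E <= ereal_sup
       [set (int_Omega (fun i x => q i x * divergence (v i) x) / normH1 v)%:E
       | v in Vh])%E }.

Definition discrete_trace (k : nat) (c : R) : Prop :=
  forall i q, poly_fun k q ->
    hsize i * \int[surf R d]_(x in GammaD G `&` elt i) (q x ^+ 2)
    <= c * \int[leb R d]_(x in (elt i)°) (q x ^+ 2).

Definition discrete_korn (k : nat) (P : fe_pair k) (c : R) : Prop :=
  forall v, Vh P v -> norm_grad2 v <= c * (normD2 v + normG2 v).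

(* [ghat] is a lifting of [gD], [Dg] the elementwise representative of its
   symmetric gradient, continuous up to the boundary of each element.  Bounded
   symmetric gradients make [ghat] continuous on the closure of Omega, so its
   trace is pointwise. *)
Definition lifting (gD ghat : E -> E) (Dg : field M) : Prop :=
  [/\ {within closure (Omega G), continuous ghat},
      forall x, GammaD G x -> ghat x = gD x,
      exists2 W, H1_grad (Omega G) ghat W &
        {ae leb R d, forall x, forall i, (elt i)° x ->
           Dg i x = sym_part (W x)} &
      forall i, {within elt i, continuous (Dg i)}].

Definition tangent_field (T : field (M -> M)) : Prop :=
  forall i,
    (forall x, elt i x ->
      (forall B, sym_mx B -> sym_mx (T i x B)) /\
      (forall a B C, sym_mx B -> sym_mx C ->
         T i x (a *: B + C) = a *: T i x B + T i x C)) /\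
    (forall B, sym_mx B -> {within elt i, continuous (fun x => T i x B)}).

End Mesh.

Section Tangents.
Variables (R : realType) (d : nat) (nu_inf nu delta p : R).
Implicit Types A B : 'M[R]_d.

Definition Delta2 A : R := delta ^+ 2 + fnorm A ^+ 2.
Definition mu_visc A : R := nu * Delta2 A `^ ((p - 2) / 2).
Definition eta A : R := nu_inf + mu_visc A.

(* Frechet derivative of A |-> eta A *: A *)
Definition DS A B : 'M[R]_d :=
  eta A *: B + (nu * (p - 2) * Delta2 A `^ ((p - 4) / 2) * frob A B) *: A.

Definition T_Pic A B : 'M[R]_d := eta A *: B.

Definition T_exN A B : 'M[R]_d :=
  eta A *: B + ((p - 2) * (mu_visc A / Delta2 A) * frob A B) *: A.

Definition clip (sigma_max : R) A : R :=
  let sigma := mu_visc A *: A in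
  if sigma == 0 then 0 else Num.min 1 (sigma_max / fnorm sigma).

Definition T_modN (sigma_max : R) A B : 'M[R]_d :=
  eta A *: B
  + (clip sigma_max A * (p - 2) * (mu_visc A / Delta2 A) * frob A B) *: A.

End Tangents.

Section Form.
Variables (R : realType) (d : nat) (G : domain R d) (Th : mesh G).
Local Notation E := 'rV[R]_d.
Local Notation M := 'M[R]_d.
Variables (nu_inf nu delta p : R).
Local Notation eta := (eta nu_inf nu delta p).
Local Notation DS := (DS nu_inf nu delta p).

Definition tangent_bounds (T : field Th (M -> M)) (Dg : field Th M)
    (eta_bar : R) : Prop :=
  {ae leb R d, forall x, forall i, (elt i)° x -> forall B, sym_mx B ->
     nu_inf * fnorm B ^+ 2 <= frob (T i x B) B /\
     fnorm (T i x B) + fnorm (DS (Dg i x) B) <= eta_bar * fnorm B}.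

Definition a_form (T : field Th (M -> M)) (Dg : field Th M)
    (gamma1 gamma2 : R) (v z : field Th E) : R :=
  int_Omega (fun i x => frob (T i x (D_ v i x)) (D_ z i x))
  - int_GammaD (fun i x => dot (mxv (T i x (D_ v i x)) (normal G x)) (z i x))
  - int_GammaD (fun i x => dot (v i x) (mxv (DS (Dg i x) (D_ z i x)) (normal G x)))
  + gamma1 * int_GammaD (fun i x =>
      (hsize i)^-1 * eta (Dg i x) * dot (v i x) (z i x))
  + gamma2 * int_GammaD (fun i x =>
      (hsize i)^-1 * dot (v i x) (normal G x) * dot (z i x) (normal G x)).

Definition coercive (V : set (field Th E)) (a : field Th E -> field Th E -> R)
    : Prop :=
  exists2 alpha : R, 0 < alpha &
    forall v, V v -> alpha * (normD2 v + normG2 v) <= a v v.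

End Form.

(* Main.v *)
Require Import Defs.
From mathcomp Require Import all_boot all_order all_algebra.
From mathcomp Require Import all_classical all_reals all_analysis.
From mathcomp Require Import measurable_realfun ring lra.
Set Implicit Arguments.
Unset Strict Implicit.
Unset Printing Implicit Defensive.
Import Order.TTheory GRing.Theory Num.Theory.
Import numFieldNormedType.Exports.
Local Open Scope classical_set_scope.
Local Open Scope ring_scope.

(** Testing with v, the volume term dominates nu_inf |Dv|^2, while both consistency
    terms are bounded by eta_bar |Dv| |v| on GammaD.  Young's inequality with weight
    the mesh size splits this into a small multiple of h |Dv|^2, absorbed in the
    volume by the discrete trace inequality applied to the (polynomial) entries of
    Dv, and a multiple of h^-1 |v|^2 compensated by the penalty.

    Integrals are real-valued with junk value 0 when they diverge, so everything must
    be shown integrable.  This needs that Borel sets are measurable for the Hausdorff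
    measure (Caratheodory's criterion), that the boundary of a bounded Lipschitz
    domain has finite Hausdorff measure (cover the local graphs by grid cells), and
    that the bounds assumed almost everywhere in the elements hold on their closure
    (continuity and density). *)

(** * Euclidean and Frobenius norms *)

(** The hypothesis bounds the sum of the two tensor norms, so both consistency terms together cost
    one product and one use of Young's inequality. Its weight is dictated by the wish to keep half
    of the volume term; with ct = 1 + |c_trace| the price on GammaD is eta_bar^2 ct / (2 nu_inf) =
    nu_inf ct (eta_bar / nu_inf)^2 / 2. Apart from the scale nu_inf it depends only on the ratio and
    on the trace constant, which explains the form of [C_tr]. The main obstacle is that GammaD is
    lower-dimensional: a bound valid almost everywhere for the volume measure gives no information
    there, and the normal is a unit vector only up to a surface-null set. Both gaps have to be
    closed before the boundary integrands are known to be bounded; boundedness and measurability on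
    sets of finite measure is the integrability criterion used throughout. *)

Section EuclideanFacts.
Variables (R : realType) (d : nat).
Implicit Types (u v x y : 'rV[R]_d) (A B : 'M[R]_d).

(** Lagrange's identity: the double sum of the squares (a_i b_j - a_j b_i)^2 is twice the defect of
    the inequality. *)
Lemma sum_cauchy_schwarz (I : finType) (a b : I -> R) :
  (\sum_i a i * b i) ^+ 2 <= (\sum_i a i ^+ 2) * (\sum_i b i ^+ 2).
Proof.
have h : 0 <= \sum_i \sum_j (a i * b j - a j * b i) ^+ 2.
  by apply: sumr_ge0 => i _; apply: sumr_ge0 => j _; rewrite sqr_ge0.
have e : \sum_i \sum_j (a i * b j - a j * b i) ^+ 2 =
    ((\sum_i a i ^+ 2) * (\sum_i b i ^+ 2) - (\sum_i a i * b i) ^+ 2) *+ 2.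
  transitivity (\sum_i \sum_j (a i ^+ 2 * b j ^+ 2 + a j ^+ 2 * b i ^+ 2
      - (a i * b i) * (a j * b j) *+ 2)).
    by apply: eq_bigr => i _; apply: eq_bigr => j _; ring.
  transitivity (\sum_i (a i ^+ 2 * (\sum_j b j ^+ 2)
      + (\sum_j a j ^+ 2) * b i ^+ 2
      - (a i * b i) * (\sum_j a j * b j) *+ 2)).
    apply: eq_bigr => i _; rewrite sumrB big_split/= -mulr_sumr -mulr_suml.
    by rewrite sumrMnl -mulr_sumr.
  rewrite sumrB big_split/= -mulr_suml -mulr_sumr sumrMnl -mulr_suml.
  ring.
by move: h; rewrite e pmulrn_lge0// subr_ge0.
Qed.

Lemma frobE A B : frob A B = \sum_(ij : 'I_d * 'I_d) A ij.1 ij.2 * B ij.1 ij.2.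
Proof. by rewrite /frob pair_bigA. Qed.

Lemma frobC A B : frob A B = frob B A.
Proof. by rewrite !frobE; apply: eq_bigr => ij _; rewrite mulrC. Qed.

Lemma frobDl A B C : frob (A + B) C = frob A C + frob B C.
Proof.
by rewrite !frobE -big_split; apply: eq_bigr => ij _; rewrite mxE mulrDl.
Qed.

Lemma frobZl c A B : frob (c *: A) B = c * frob A B.
Proof.
by rewrite !frobE mulr_sumr; apply: eq_bigr => ij _; rewrite mxE mulrA.
Qed.

Lemma frob_ge0 A : 0 <= frob A A.
Proof. by rewrite frobE; apply: sumr_ge0 => ij _; rewrite -expr2 sqr_ge0. Qed.

Lemma dot_ge0 u : 0 <= dot u u.
Proof. by apply: sumr_ge0 => i _; rewrite -expr2 sqr_ge0. Qed.

Lemma fnorm_ge0 A : 0 <= fnorm A. Proof. exact: sqrtr_ge0. Qed.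

Lemma enorm_ge0 u : 0 <= enorm u. Proof. exact: sqrtr_ge0. Qed.

Lemma fnorm_sqr A : fnorm A ^+ 2 = frob A A.
Proof. by rewrite sqr_sqrtr// frob_ge0. Qed.

Lemma enorm_sqr u : enorm u ^+ 2 = dot u u.
Proof. by rewrite sqr_sqrtr// dot_ge0. Qed.

Lemma fnorm_sqrE A : fnorm A ^+ 2 = \sum_i \sum_j A i j ^+ 2.
Proof.
by rewrite fnorm_sqr; apply: eq_bigr => i _; apply: eq_bigr => j _; rewrite expr2.
Qed.

Lemma ler_of_sqr (a b : R) : 0 <= b -> a ^+ 2 <= b ^+ 2 -> a <= b.
Proof.
move=> b0 ab; have [a0|a0] := ltP a 0; first by rewrite ltW// (lt_le_trans a0).
by rewrite -(ler_sqr a0 b0).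
Qed.

Lemma normr_frob A B : `|frob A B| <= fnorm A * fnorm B.
Proof.
apply: ler_of_sqr; first by rewrite mulr_ge0// fnorm_ge0.
rewrite real_normK ?num_real// exprMn !fnorm_sqr !frobE.
by apply: le_trans (sum_cauchy_schwarz _ _) _; under eq_bigr do rewrite expr2;
   under [X in _ * X]eq_bigr do rewrite expr2.
Qed.

Lemma normr_dot u v : `|dot u v| <= enorm u * enorm v.
Proof.
apply: ler_of_sqr; first by rewrite mulr_ge0// enorm_ge0.
rewrite real_normK ?num_real// exprMn !enorm_sqr /dot.
by apply: le_trans (sum_cauchy_schwarz _ _) _; under eq_bigr do rewrite expr2;
   under [X in _ * X]eq_bigr do rewrite expr2.
Qed.

Lemma enorm_mxv A u : enorm (mxv A u) <= fnorm A * enorm u.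
Proof.
apply: ler_of_sqr; first by rewrite mulr_ge0 ?fnorm_ge0 ?enorm_ge0.
rewrite exprMn fnorm_sqrE !enorm_sqr /dot mulr_suml.
apply: ler_sum => i _; rewrite -expr2 /mxv mxE.
have -> : \sum_j u 0 j * A^T j i = \sum_j A i j * u 0 j.
  by apply: eq_bigr => j _; rewrite mxE mulrC.
by apply: le_trans (sum_cauchy_schwarz _ _) _;
   under [X in _ * X]eq_bigr do rewrite expr2.
Qed.

Lemma normr_dot_mxv A u v : `|dot (mxv A u) v| <= fnorm A * enorm u * enorm v.
Proof.
by apply: le_trans (normr_dot _ _) _; rewrite ler_wpM2r ?enorm_ge0// enorm_mxv.
Qed.

Lemma fnorm_triangle A B : fnorm (A + B) <= fnorm A + fnorm B.
Proof.
apply: ler_of_sqr; first by rewrite addr_ge0// fnorm_ge0.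
have := ler_norm (frob A B); have := normr_frob A B.
rewrite sqrrD !fnorm_sqr frobDl !(frobC _ (A + B)) !frobDl (frobC B A).
lra.
Qed.

Lemma fnormZ c A : fnorm (c *: A) = `|c| * fnorm A.
Proof.
by rewrite /fnorm frobZl frobC frobZl mulrA -expr2 sqrtrM ?sqr_ge0// sqrtr_sqr.
Qed.

Lemma dotC u v : dot u v = dot v u.
Proof. by apply: eq_bigr => i _; rewrite mulrC. Qed.

Lemma dotDl u v x : dot (u + v) x = dot u x + dot v x.
Proof. by rewrite -big_split; apply: eq_bigr => i _; rewrite mxE mulrDl. Qed.

Lemma dotZl c u v : dot (c *: u) v = c * dot u v.
Proof. by rewrite mulr_sumr; apply: eq_bigr => i _; rewrite mxE mulrA. Qed.

Lemma dotBl u v x : dot (u - v) x = dot u x - dot v x.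
Proof. by rewrite dotDl -scaleN1r dotZl mulN1r. Qed.

Lemma coord_le_enorm u i : `|u 0 i| <= enorm u.
Proof.
apply: ler_of_sqr; first exact: enorm_ge0.
rewrite real_normK ?num_real// enorm_sqr /dot (bigD1 i)//= -expr2 lerDl.
by apply: sumr_ge0 => j _; rewrite -expr2 sqr_ge0.
Qed.

(** The crude factor [d], from d <= d^2, avoids square roots; it only serves continuity and
    finiteness arguments. *)
Lemma enorm_le_coord u (M : R) : (forall i, `|u 0 i| <= M) -> 
  enorm u <= d%:R * M.
Proof.
move=> uM; have [M0|M0] := leP 0 M; last first.
  suff -> : enorm u = 0.
    case: (posnP d) => [->|d0]; first by rewrite mul0r.
    by have := le_lt_trans (uM (Ordinal d0)) M0; rewrite normr_lt0.
  rewrite /enorm /dot big1 ?sqrtr0// => i.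
  by have := le_lt_trans (uM i) M0; rewrite normr_lt0.
apply: ler_of_sqr; first by rewrite mulr_ge0.
rewrite enorm_sqr exprMn /dot (@le_trans _ _ (\sum_(i < d) M ^+ 2))//.
  apply: ler_sum => i _; rewrite -expr2 -real_normK ?num_real//.
  by rewrite ler_sqr ?nnegrE.
rewrite sumr_const card_ord -[leLHS]mulr_natl; apply: ler_wpM2r; first exact: sqr_ge0.
by rewrite -natrX ler_nat; case: (d) => // n; rewrite leq_pmulr.
Qed.

End EuclideanFacts.

(** * Hausdorff measure of Borel sets and of Lipschitz boundaries *)

Section MetricOuterMeasure.
Local Open Scope ereal_scope.
Variables (R : realType) (V : normedModType R).
Implicit Types (A B U : set V).

Definition apart A B := exists2 e : R, (0 < e)%R &
  forall x y, A x -> B y -> (e <= `|x - y|)%R.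

Variable mu : {outer_measure set V -> \bar R}.
Hypothesis mu_metric : forall A B, apart A B -> mu A + mu B <= mu (A `|` B).

(* Caratheodory's criterion.  [shell n.+1] is apart from [core n], so that the
   measures of the shells sum to at most twice [mu A] and their tails vanish. *)
Lemma metric_outer_measure_open U : open U -> mu.-caratheodory U.
Proof.
move=> oU; apply: le_caratheodory_measurable => A.
have [->|Aoo] := eqVneq (mu A) +oo; first by rewrite leey.
have {}Aoo : mu A < +oo by rewrite ltey.
pose core n := A `&` [set x | forall y, ~ U y -> (n.+1%:R^-1 <= `|x - y|)%R].
pose shell n := core n.+1 `\` core n.
have inv_lt m n : (n < m)%N -> (m.+1%:R^-1 < n.+1%:R^-1 :> R)%R.
  by move=> nm; rewrite ltf_pV2 ?posrE// ltr_nat.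
have coreS m n : (n <= m)%N -> core n `<=` core m.
  move=> nm x [Ax Ux]; split=> // y /Ux; apply: le_trans.
  by rewrite lef_pV2 ?posrE// ler_nat.
have core_shell n : mu (core n) + mu (shell n.+1) <= mu (core n.+2).
  apply: (@le_trans _ _ (mu (core n `|` shell n.+1))); last first.
    apply: le_outer_measure => x [|[]//]; apply: coreS.
    by rewrite ltnW.
  (* A point of [shell n.+1] lies within 1/(n+2) of some z outside U, while [core n] keeps distance
     1/(n+1) from z; the triangle inequality leaves the difference. *)
  apply: mu_metric; exists (n.+1%:R^-1 - n.+2%:R^-1)%R.
    by rewrite subr_gt0 inv_lt.
  move=> x y [_ xU] [[Ay _] yU].
  have [z [Uz yz]] : exists z, ~ U z /\ (`|y - z| < n.+2%:R^-1)%R.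
    apply: contrapT => h; apply: yU; split=> // z Uz; rewrite leNgt.
    by apply/negP => yz; apply: h; exists z.
  move: (xU z Uz) yz; move: (n.+1%:R^-1)%R (n.+2%:R^-1)%R => a b.
  have : (`|x - z| <= `|x - y| + `|y - z|)%R.
    by rewrite (le_trans _ (ler_normD _ _))// subrKA.
  by move=> /= ? ? ?; lra.
(* [core_shell] advances by two indices, so even and odd shells telescope separately; the two cores
   on the right carry the two parities. *)
have sum_shell n :
    \sum_(0 <= j < n) mu (shell j.+1) <= mu (core n) + mu (core n.+1).
  elim: n => [|n ih]; first by rewrite big_geq// adde_ge0.
  rewrite big_nat_recr//=; apply: (le_trans (leeD ih (le_refl _))).
  rewrite (addeC (mu (core n))) -addeA; exact: leeD.
have shell_fin : \sum_(0 <= j <oo) mu (shell j.+1) < +oo.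
  apply: (@le_lt_trans _ _ (mu A + mu A)); last by rewrite lte_add_pinfty.
  apply: lime_le; first exact: is_cvg_nneseries.
  apply: nearW => n; apply: (le_trans (sum_shell n)).
  by apply: leeD; apply: le_outer_measure => x [].
have tail0 := nneseries_tail_cvg shell_fin (fun k _ => outer_measure_ge0 mu _).
have AU n : A `&` U `<=` core n.+1 `|` \bigcup_(k in ~` `I_n) shell k.+1.
  move=> x [Ax Ux].
  have [N xN] : exists N, core N x.
    have /nbhs_normP[e /= e0 eU] : nbhs x U by exact: open_nbhs_nbhs.
    have [m _ /(_ m (leqnn m)) /= me] := near_infty_natSinv_lt (PosNum e0).
    exists m; split=> // y Uy; rewrite leNgt; apply/negP => xy; apply: Uy.
    by apply: eU => /=; exact: lt_trans me.
  (* Descent to the first core containing x: either its index is at most n+1, or x lies in a shell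
     of the tail. *)
  elim: N xN => [|N ih] xN; first by left; apply: coreS xN.
  have [/ih//|xN'] := pselect (core N x).
  have [Nn|] := leqP N n; first by left; apply: coreS xN.
  case: N xN xN' {ih} => // N xN xN' nN; right; exists N => //=.
  by apply/negP; rewrite -leqNgt -ltnS.
have metricU n : mu (core n) + mu (A `&` ~` U) <= mu A.
  apply: (@le_trans _ _ (mu (core n `|` (A `&` ~` U)))); last first.
    by apply: le_outer_measure => x [[]|[]].
  apply: mu_metric; exists n.+1%:R^-1%R; first by rewrite invr_gt0.
  by move=> x y [_ xU] [_ Uy]; exact: xU.
have bound n : mu (A `&` U) + mu (A `&` ~` U) <=
    mu A + \sum_(n <= j <oo) mu (shell j.+1).
  apply: (@le_trans _ _ (mu (core n.+1) + \sum_(n <= j <oo) mu (shell j.+1)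
      + mu (A `&` ~` U))); last by rewrite addeAC leeD2r.
  rewrite leeD2r// (le_trans (le_outer_measure mu _ _ (AU n)))//.
  rewrite (le_trans (outer_measureU2 _ _ _))// leeD2l//.
  exact: outer_measure_sigma_subadditive_tail.
have cvgA : (fun n => mu A + \sum_(n <= j <oo) mu (shell j.+1)) @ \oo --> mu A.
  rewrite -[X in _ --> X]adde0; apply: cvgeD => //; last exact: cvg_cst.
  by rewrite ge0_adde_def// inE.
by apply: cvge_ge cvgA; exact: nearW.
Qed.

End MetricOuterMeasure.

(** * The Hausdorff measure as a metric outer measure *)

Section HausdorffFacts.
Local Open Scope ereal_scope.
Variables (R : realType) (d s : nat).
Implicit Types (A B X : set 'rV[R]_d).

Lemma ediam_le X (e : R) : (0 <= e)%R ->
  (forall x y, X x -> X y -> (enorm (x - y) <= e)%R) -> ediam X <= e%:E.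
Proof.
move=> e0 Xe; rewrite /ediam ge_max lee_fin e0/=.
by apply: ge_ereal_sup => _ [[x y] /= [Xx Xy] <-]; rewrite lee_fin Xe.
Qed.

Lemma enorm_le_ediam X x y : X x -> X y -> (enorm (x - y))%:E <= ediam X.
Proof.
move=> Xx Xy; rewrite /ediam le_max; apply/orP; right.
by apply: ereal_sup_ubound; exists (x, y).
Qed.

Lemma normr_le_enorm (x : 'rV[R]_d) : (`|x| <= enorm x)%R.
Proof.
rewrite [leLHS]/Num.norm /= mx_normrE; apply/bigmax_leP; split.
  exact: enorm_ge0.
by move=> [i j] _ /=; rewrite (ord1 i) coord_le_enorm.
Qed.

Lemma coord_le_normr (x : 'rV[R]_d) i : (`|x 0%R i| <= `|x|)%R.
Proof.
by rewrite [leRHS]/Num.norm /= mx_normrE; apply/bigmax_geP; right; exists (ord0, i).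
Qed.

Lemma enorm_le_normr (x : 'rV[R]_d) : (enorm x <= d%:R * `|x|)%R.
Proof. by apply: enorm_le_coord => i; exact: coord_le_normr. Qed.

(** At a scale below the separation of A and B no covering set can meet both, so every cover splits
    into a cover of A and one of B. *)
Lemma hausdorff_metric A B : apart A B ->
  hausdorff s A + hausdorff s B <= hausdorff s (A `|` B).
Proof.
move=> [e0 e0_gt0 AB].
pose g e := @hausdorff_gauge R d s e.
have g_ge0 e X : 0 <= g e X by exact: hausdorff_gauge_ge0.
have sub e : (0 < e)%R -> (e < e0)%R ->
    mu_ext (g e) A + mu_ext (g e) B <= mu_ext (g e) (A `|` B).
  move=> e_gt0 ee0; apply: le_ereal_inf_tmp => _ [F [mF ABF] <-].
  (* A set of infinite gauge makes the claim trivial; otherwise every [F k] has diameter at most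
     e. *)
  have [[k Fk]|Ffin] := pselect (exists k, g e (F k) = +oo).
    by rewrite (nneseries_pinfty _ _ Fk) ?leey.
  have Fe k x y : F k x -> F k y -> (enorm (x - y) <= e)%R.
    move=> Fx Fy; have : g e (F k) <> +oo by move=> ?; apply: Ffin; exists k.
    rewrite /g /hausdorff_gauge; case: ifPn => [/eqP F0|_].
      by move: Fx; rewrite F0.
    case: ifPn => // Fke _; rewrite -lee_fin; apply: le_trans Fke.
    exact: enorm_le_ediam.
  (* Sets meeting A go to [FA]; the remaining ones still cover B, and the empty fillers cost
     nothing. *)
  pose P k := `[< F k `&` A !=set0 >].
  pose FA k := if P k then F k else set0.
  pose FB k := if P k then set0 else F k.
  have AFA : mu_ext (g e) A <= \sum_(0 <= k <oo) g e (FA k).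
    apply: ereal_inf_lbound; exists FA => //; split.
      by move=> k; rewrite /FA; case: ifP.
    move=> x Ax; have [|k _ Fx] := ABF x; first by left.
    exists k => //; rewrite /FA /P; case: asboolP => // -[].
    by exists x.
  have BFB : mu_ext (g e) B <= \sum_(0 <= k <oo) g e (FB k).
    apply: ereal_inf_lbound; exists FB => //; split.
      by move=> k; rewrite /FB; case: ifP.
    move=> y By; have [|k _ Fy] := ABF y; first by right.
    exists k => //; rewrite /FB /P; case: asboolP => // -[x [Fx Ax]].
    have := lt_le_trans ee0 (le_trans (AB _ _ Ax By) (normr_le_enorm _)).
    by rewrite ltNge (Fe k).
  apply: (le_trans (leeD AFA BFB)).
  rewrite -(@nneseriesD _ _ _ xpredT 0) => [|k _ _|k _ _]; [|exact: g_ge0..].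
  apply: lee_nneseries => k _; first by rewrite adde_ge0.
  rewrite /FA /FB; case: (P k).
    by rewrite [X in _ + X]hausdorff_gauge0 adde0.
  by rewrite [X in X + _]hausdorff_gauge0 add0e.
have mono e e' X : (0 < e' <= e)%R -> mu_ext (g e) X <= mu_ext (g e') X.
  move=> /andP[e'0 e'e]; apply: le_ereal_inf_tmp => _ [F FX <-].
  apply: (@le_trans _ _ (\sum_(0 <= k <oo) g e (F k))).
    by apply: ereal_inf_lbound; exists F.
  apply: lee_nneseries => // k _; rewrite /g /hausdorff_gauge.
  case: ifP => // _; case: ifPn => [_|h].
    case: ifPn => // _; exact: leey.
  case: ifPn => // h'; apply: contraNT h => _.
  by rewrite (le_trans h')// lee_fin.
have main e1 e2 : (0 < e1)%R -> (0 < e2)%R ->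
    mu_ext (g e1) A + mu_ext (g e2) B <= hausdorff s (A `|` B).
  (* The two suprema run over independent scales. Refining the scale only increases [mu_ext], so a
     common scale below both and below the separation suffices. *)
  move=> e1_gt0 e2_gt0; pose e := Num.min (Num.min e1 e2) (e0 / 2)%R.
  have e_gt0 : (0 < e)%R by rewrite !lt_min e1_gt0 e2_gt0 divr_gt0.
  apply: (@le_trans _ _ (mu_ext (g e) A + mu_ext (g e) B)).
    by apply: leeD; apply: mono; rewrite e_gt0 /e !ge_min lexx ?orbT.
  apply: le_trans (sub e e_gt0 _) _; last exact: mu_ext_le_hausdorff.
  by rewrite /e gt_min; apply/orP; right; lra.
(* Taking the suprema one at a time moves the other term across the inequality, which requires
   finite values. *)
have [ABoo|ABfin] := eqVneq (hausdorff s (A `|` B)) +oo.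
  by rewrite ABoo leey.
have fin X : X `<=` A `|` B -> hausdorff s X \is a fin_num.
  move=> XAB; rewrite ge0_fin_numE ?hausdorff_ge0//.
  by rewrite (le_lt_trans (le_hausdorff _ XAB)) ?ltey.
rewrite -leeBrDr; last by apply: fin; exact: subsetUr.
apply: ge_ereal_sup => _ [e1 e1_gt0 <-].
rewrite leeBrDr; last by apply: fin; exact: subsetUr.
rewrite addeC -leeBrDr; last first.
  rewrite ge0_fin_numE; last exact: mu_ext_ge0.
  rewrite (@le_lt_trans _ _ (hausdorff s A))//.
    exact: mu_ext_le_hausdorff.
  by rewrite -ge0_fin_numE ?hausdorff_ge0// fin//; exact: subsetUl.
apply: ge_ereal_sup => _ [e2 e2_gt0 <-].
rewrite leeBrDr; last first.
  rewrite ge0_fin_numE; last exact: mu_ext_ge0.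
  rewrite (@le_lt_trans _ _ (hausdorff s A))//.
    exact: mu_ext_le_hausdorff.
  by rewrite -ge0_fin_numE ?hausdorff_ge0// fin//; exact: subsetUl.
by rewrite addeC main.
Qed.

End HausdorffFacts.

Lemma surface_measurable_open (R : realType) (d : nat) (U : set 'rV[R]_d) :
  open U -> measurable (U : set (surface_type R d)).
Proof.
by apply: metric_outer_measure_open => A B; exact: hausdorff_metric.
Qed.

Lemma borel_measurable_surface (R : realType) (d : nat) (A : set 'rV[R]_d) :
  measurable (A : set (borel R d)) -> measurable (A : set (surface_type R d)).
Proof.
apply: smallest_sub; first exact: (@sigma_algebra_measurable _ (surface_type R d)).
by move=> U; exact: surface_measurable_open.
Qed.

(** * Local graph charts of a Lipschitz boundary *)

Section Graph.
Variables (R : realType) (d : nat).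
Local Notation E := 'rV[R]_d.
Implicit Types (O : set E) (x y e : E) (phi : E -> R).

Lemma nbhs_rowP x (P : set E) :
  nbhs x P <-> exists2 r : R, 0 < r & forall y, `|x - y| < r -> P y.
Proof.
by split=> [/(@nbhs_normP R E x)[r /= r0 rP]|[r r0 rP]];
  [exists r|apply/(@nbhs_normP R E x); exists r].
Qed.

Lemma continuous_dot e : continuous (fun x : E => dot x e).
Proof.
apply: continuous_big => [|i _ x]; first exact: add_continuous.
apply: continuousM; last exact: cst_continuous.
exact: coord_continuous.
Qed.

Lemma lipschitz_continuous phi (L : R) :
  (forall x y, `|phi x - phi y| <= L * enorm (x - y)) -> continuous phi.
Proof.
move=> phiL x; apply/(@cvgrPdist_lt _ _ _ _ (nbhs_filter (x : E))) => e e0.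
pose C := `|L| * d%:R + 1.
have C0 : 0 < C by rewrite ltr_wpDl// mulr_ge0.
apply/nbhs_rowP; exists (e / C); first by rewrite divr_gt0.
move=> y xy; rewrite (le_lt_trans (phiL x y))//.
rewrite (@le_lt_trans _ _ (C * `|x - y|))//; last by rewrite mulrC -ltr_pdivlMr.
rewrite (@le_trans _ _ (`|L| * (d%:R * `|x - y|)))//.
  by rewrite (le_trans (ler_wpM2r (enorm_ge0 _) (ler_norm L)))// ler_wpM2l// enorm_le_normr.
by rewrite mulrA ler_wpM2r// lerDl.
Qed.

(** By continuity of x.e - phi x both strict inequalities are open conditions: above the graph
    points are interior to O, below it they have a neighbourhood missing O, so boundary points can
    only lie on the graph. *)
Lemma lipschitz_boundary_chart O x0 : lipschitz_boundary O -> bd O x0 ->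
  exists (e : E) (phi : E -> R) (L r : R),
  [/\ enorm e = 1, 0 < r,
      forall x y, `|phi x - phi y| <= L * enorm (x - y),
      forall x t, phi (x + t *: e) = phi x &
      [/\ forall x, `|x0 - x| < r -> phi x < dot x e -> O° x,
          forall x, `|x0 - x| < r -> dot x e < phi x -> ~ closure O x &
          forall x, `|x0 - x| < r -> bd O x -> phi x = dot x e]].
Proof.
move=> lipO /lipO[e [phi [L [U [e1 phiL phie Ux0 OU]]]]].
have /nbhs_rowP[r r0 rU] := Ux0.
exists e, phi, L, r.
have gcont : continuous (fun x => dot x e - phi x).
  move=> x; apply: (@cvgB _ _ _ _ (nbhs_filter (x : E))).
    exact: continuous_dot.
  exact: lipschitz_continuous phiL x.
have near_ball x : `|x0 - x| < r -> \forall y \near x, `|x0 - y| < r.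
  move=> xr; apply: (@open_nbhs_nbhs _ x (ball_ (fun x => `|x|) x0 r)).
  by split=> //; rewrite ball_normE; exact: ball_open.
have above x : `|x0 - x| < r -> phi x < dot x e -> O° x.
  move=> xr; rewrite -subr_gt0 => gx.
  have hg : \forall y \near x, 0 < dot y e - phi y.
    exact: (gcont x _ (open_nbhs_nbhs (conj (@open_gt _ (0:R)) gx))).
  apply: filterS2 (near_ball _ xr) hg => y yr gy.
  by apply/OU; [exact: rU|rewrite -subr_gt0].
have below x : `|x0 - x| < r -> dot x e < phi x -> ~ closure O x.
  move=> xr; rewrite -subr_lt0 => gx clx.
  have hg : \forall y \near x, dot y e - phi y < 0.
    exact: (gcont x _ (open_nbhs_nbhs (conj (@open_lt _ (0:R)) gx))).
  have [y [Oy [yr gy]]] := clx _ (filterI (near_ball _ xr) hg).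
  have /OU : U y by exact: rU.
  by case=> /(_ Oy); rewrite -subr_gt0 ltNge (ltW gy).
split => //; split => // x xr [clx nix].
by case: (ltgtP (phi x) (dot x e)) => // h; [case: nix; exact: above|case: (below x)].
Qed.

(** A Lipschitz domain has no slits: just below the graph, in direction -e, there are points outside
    the closure. The mesh covers the closure of Omega, so this is what places the interiors of the
    elements inside Omega. *)
Lemma interior_closure_lipschitz O : open O -> lipschitz_boundary O ->
  (closure O)° `<=` O.
Proof.
move=> oO lipO x0 ix0; apply: contrapT => Ox0.
have bx0 : bd O x0.
  split; first exact: interior_subset ix0.
  by move/interior_subset.
have [e [phi [L [r [e1 r0 phiL phie [above below graph]]]]]] :=
  lipschitz_boundary_chart lipO bx0.
have /nbhs_rowP[r' r'0 r'O] := ix0.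
pose t := Num.min r r' / 2.
have m0 : 0 < Num.min r r' by rewrite lt_min r0.
have t0 : 0 < t by rewrite divr_gt0.
pose y := x0 + (- t) *: e.
have x0y : `|x0 - y| < Num.min r r'.
  rewrite /y opprD addrA subrr add0r scaleNr opprK normrZ.
  rewrite (@le_lt_trans _ _ (t * 1))//.
    by rewrite gtr0_norm// ler_wpM2l ?(ltW t0)// -e1 normr_le_enorm.
  by rewrite mulr1 /t ltr_pdivrMr// ltr_pMr// ltr1n.
have [yr yr'] : `|x0 - y| < r /\ `|x0 - y| < r' by move: x0y; rewrite lt_min => /andP.
have : closure O y by exact: r'O.
apply: below => //; rewrite phie (graph x0)//; last by rewrite subrr normr0.
by rewrite dotDl dotZl -enorm_sqr e1 expr1n mulr1 gtrDl oppr_lt0.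
Qed.

Lemma closure_bounded (A : set E) (M : R) : (forall x, A x -> enorm x <= M) ->
  forall x, closure A x -> `|x| <= M.
Proof.
move=> AM x clx.
have cl : closed [set x : E | `|x| <= M].
  have := @preimage_closed _ _ (fun x : E => `|x|) [set y | y <= M].
  by apply; [move=> y _; exact: norm_continuous|exact: closed_le].
move/closure_id: cl; suff : closure [set x : E | `|x| <= M] x by move=> + h; rewrite -h.
by apply: closureS clx => y /AM; apply: le_trans; exact: normr_le_enorm.
Qed.

Lemma compact_bd O (M : R) : (forall x, O x -> enorm x <= M) -> compact (bd O).
Proof.
move=> OM; apply: bounded_closed_compact; last first.
  apply: closedI; first exact: closed_closure.
  by apply: open_closedC; exact: open_interior.
exists M; split; first exact: num_real.
by move=> M' MM' x [/(closure_bounded OM)/le_trans + _]; apply; exact: ltW.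
Qed.

End Graph.

(** * Finite Hausdorff measure by grid covers *)

Section HausdorffFinite.
Variables (R : realType) (d : nat).
Local Notation E := 'rV[R]_d.

Lemma borel_closed (A : set E) : closed A -> measurable (A : set (borel R d)).
Proof.
move=> cA; rewrite -(setCK A); apply: measurableC.
by apply: sub_sigma_algebra; exact: closed_openC.
Qed.

(* P parametrizes S over the unit n-cube with Lipschitz inverse; S is covered by
   the N^n cells of the grid of step 1/N, of diameter at most K/N. *)
Lemma hausdorff_grid_fin n (S : set E) (P : E -> 'I_n -> R) (K : R) :
  0 <= K -> closed S -> (forall i, continuous (P^~ i)) ->
  (forall x i, S x -> 0 <= P x i < 1) ->
  (forall x y r, 0 <= r -> S x -> S y ->
    (forall i, `|P x i - P y i| <= r) -> enorm (x - y) <= K * r) ->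
  (hausdorff n S < +oo)%E.
Proof.
move=> K0 cS cP P01 PK.
pose c := unit_ball_vol R n / 2 ^+ n.
have c0 : 0 <= c by rewrite divr_ge0 ?unit_ball_vol_ge0.
apply: (@le_lt_trans _ _ (c * K ^+ n)%:E); last exact: ltry.
apply: ge_ereal_sup => _ [e e0 <-].
have [N N0 KNe] : exists2 N, 0 < N%:R :> R & K / N%:R <= e.
  exists (Num.truncn (K / e)).+1; first by rewrite ltr0n.
  rewrite ler_pdivrMr// mulrC -ler_pdivrMr//.
  by rewrite ltW// truncnS_gt.
pose I : finType := {ffun 'I_n -> 'I_N}.
pose C (m : I) : set E := S `&`
  [set x | forall i, (m i)%:R / N%:R <= P x i <= (m i).+1%:R / N%:R].
have C_diam m : (ediam (C m) <= (K / N%:R)%:E)%E.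
  apply: ediam_le; first by rewrite divr_ge0// ltW.
  move=> x y [Sx mx] [Sy my]; apply: PK => // i.
  have := mx i; have := my i; rewrite -natr1 mulrDl mul1r ler_norml.
  by move: ((m i)%:R / N%:R : R) (N%:R^-1 : R) => a b; lra.
have C_closed m : closed (C m).
  apply: closedI => //.
  have -> : [set x | forall i, (m i)%:R / N%:R <= P x i <= (m i).+1%:R / N%:R] =
      \bigcap_i ((P^~ i) @^-1` [set y | y >= (m i)%:R / N%:R] `&`
                 (P^~ i) @^-1` [set y | y <= (m i).+1%:R / N%:R]).
    apply/seteqP; split => [x mx i _|x mx i].
      by have /andP[] := mx i; split.
    by apply/andP; have := mx i Logic.I.
  apply: closed_bigI => i _; apply: closedI.
    by apply: preimage_closed; [move=> x _; exact: cP|exact: closed_ge].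
  by apply: preimage_closed; [move=> x _; exact: cP|exact: closed_le].
(* The finitely many cells are numbered to form a sequence, continued by empty sets of gauge 0. *)
pose F k := if insub k is Some j then C (enum_val (j : 'I_#|I|)) else set0.
apply: (@le_trans _ _ (\sum_(0 <= k <oo) hausdorff_gauge n e (F k))%E).
  apply: ereal_inf_lbound; exists F => //; split.
    by move=> k; rewrite /F; case: insubP => [j _ _|_] //; exact: borel_closed.
  move=> x Sx.
  (* The strict bound P x i < 1 keeps the index of the cell below N. *)
  have ltN i : (Num.truncn (P x i * N%:R) < N)%N.
    have /andP[h0 h1] := P01 x i Sx.
    by rewrite truncn_lt_nat ?mulr_ge0// gtr_pMl.
  pose m : I := [ffun i => Ordinal (ltN i)].
  exists (enum_rank m) => //.
  rewrite /F insubT//= => lt_m.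
  have -> : Sub (nat_of_ord (enum_rank m)) lt_m = enum_rank m by exact: val_inj.
  rewrite enum_rankK; split=> // i; rewrite ffunE /=.
  have /andP[h0 h1] := P01 x i Sx.
  have /truncn_itv/andP[t1 t2] : 0 <= P x i * N%:R by rewrite mulr_ge0.
  by rewrite ler_pdivrMr// t1 ler_pdivlMr// ltW.
have gF k : (k < #|I|)%N -> (hausdorff_gauge n e (F k) <= (c * (K / N%:R) ^+ n)%:E)%E.
  move=> kI; rewrite /F insubT /hausdorff_gauge.
  case: ifPn => _.
    by rewrite lee_fin mulr_ge0// exprn_ge0// divr_ge0.
  rewrite ifT; last by rewrite (le_trans (C_diam _))// lee_fin.
  rewrite [leRHS]EFinM lee_wpmul2l ?lee_fin//.
  have x0 : (0 <= ediam (C (enum_val (Sub k kI : 'I_#|I|))))%E.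
    by rewrite /ediam le_max lexx.
  rewrite EFin_expe; elim: (n) => // j ih; rewrite !expeS.
  by apply: lee_pmul => //; rewrite expe_ge0.
rewrite (nneseries_split 0 #|I|); last by move=> k _; exact: hausdorff_gauge_ge0.
rewrite add0n eseries0 ?adde0; last first.
  move=> k Ik _; rewrite /F insubF ?hausdorff_gauge0//.
  by apply/negbTE; rewrite -leqNgt.
rewrite big_mkord.
apply: (@le_trans _ _ (\sum_(k < #|I|) (c * (K / N%:R) ^+ n)%:E)%E).
  by apply: lee_sum => k _; exact: gF.
rewrite sumEFin lee_fin sumr_const card_ord card_ffun !card_ord.
(* N^n cells of gauge at most c (K/N)^n: the powers of N cancel, so the bound is the same at every
   scale e. *)
rewrite -[leLHS]mulr_natl natrX expr_div_n mulrA [_ * c]mulrC -mulrA.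
by rewrite ler_wpM2l// mulrCA divff ?mulr1// expf_neq0// gt_eqF.
Qed.

End HausdorffFinite.

(** * Finite surface measure of bounded Lipschitz boundaries *)

Section LipschitzBoundary.
Variables (R : realType) (n : nat).
Local Notation E := 'rV[R]_n.+1.
Implicit Types (O : set E) (x y e : E).

Let proj e x : E := x - dot x e *: e.

Let projB e x y : proj e (x - y) = proj e x - proj e y.
Proof. by rewrite /proj dotBl scalerBl opprD addrACA -opprD. Qed.

Let dot_proj e x : enorm e = 1 -> dot (proj e x) e = 0.
Proof. by move=> e1; rewrite /proj dotBl dotZl -enorm_sqr e1 expr1n mulr1 subrr. Qed.

Let coord_unit e i : enorm e = 1 -> `|e 0 i| <= 1.
Proof. by move=> <-; exact: coord_le_enorm. Qed.

Let coord_proj e x i : enorm e = 1 -> `|proj e x 0 i| <= 2 * enorm x.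
Proof.
move=> e1; rewrite /proj !mxE (le_trans (ler_normB _ _))//.
have := coord_le_enorm x i; have := normr_dot x e; rewrite e1 mulr1 normrM.
have := coord_unit i e1; have := normr_ge0 (dot x e).
move: `|dot x e| `|e 0 i| `|x 0 i| (enorm x) => a b c s a0 b1 ad cs; nra.
Qed.

(* Orthogonality to e expresses the j-th coordinate through the others. *)
Let coord_proj_lift e x (j : 'I_n.+1) (r : R) : enorm e = 1 -> e 0 j != 0 -> 0 <= r ->
  (forall i, `|proj e x 0 (lift j i)| <= r) ->
  forall i, `|proj e x 0 i| <= (1 + n%:R / `|e 0 j|) * r.
Proof.
move=> e1 ej0 r0 pr i.
have ej_gt0 : 0 < `|e 0 j| by rewrite normr_gt0.
case: (unliftP j i) => [k|] ->.
  rewrite (le_trans (pr k))// ler_peMl// lerDl divr_ge0//.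
have : `|proj e x 0 j * e 0 j| <= n%:R * r.
  have : dot (proj e x) e = 0 by exact: dot_proj.
  rewrite /dot (bigD1_ord j)//= => /eqP; rewrite addr_eq0 => /eqP ->.
  rewrite normrN (le_trans (ler_norm_sum _ _ _))//.
  rewrite (@le_trans _ _ (\sum_(k < n) r))//; last first.
    by rewrite sumr_const card_ord mulr_natl.
  apply: ler_sum => k _; rewrite normrM (le_trans _ (pr k))//.
  by rewrite ler_piMr// coord_unit.
rewrite normrM -ler_pdivlMr// => /le_trans; apply.
by rewrite mulrDl mul1r mulrAC lerDr.
Qed.

(* The graph is parametrized by the projection along e, in which the j-th
   coordinate is dropped. *)
Lemma hausdorff_bd_local O x0 : lipschitz_boundary O -> bd O x0 ->
  exists2 r : R, 0 < r &
    (hausdorff n (bd O `&` [set x | (`|x0 - x| <= r)%R]) < +oo)%E.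
Proof.
move=> lipO bx0.
have [e [phi [L [r2 [e1 r20 phiL phie [above below graph]]]]]] :=
  lipschitz_boundary_chart lipO bx0.
have [j ej0] : exists j, e 0 j != 0.
  apply: contrapT => h; have : enorm e = 0.
    rewrite /enorm /dot big1 ?sqrtr0// => i _.
    have [->|ei] := eqVneq (e 0 i) 0; first by rewrite mulr0.
    by exfalso; apply: h; exists i.
  by rewrite e1 => /eqP; rewrite oner_eq0.
pose r := r2 / 2; have r0 : 0 < r by rewrite divr_gt0.
have rr2 : r < r2 by rewrite /r ltr_pdivrMr// ltr_pMr// ltr1n.
exists r => //; set S := bd O `&` _.
(* On the ball of radius r a coordinate of the projection is at most 2 (n+1) r = D/4, so after
   division by D and a shift by 1/2 the parameters stay in [1/4, 3/4]. *)
pose D := 8 * n.+1%:R * r.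
have D0 : 0 < D by rewrite !mulr_gt0.
pose K1 := (1 + n%:R / `|e 0 j|) * D.
have K10 : 0 <= K1 by rewrite mulr_ge0 ?(ltW D0)// addr_ge0// divr_ge0.
(* [K1] bounds the coordinates of the projected part, the second summand the part along e through
   the Lipschitz constant of phi; the outer n+1 passes from coordinates to the Euclidean norm. *)
pose K := n.+1%:R * (K1 + `|L| * (n.+1%:R * K1)).
pose P x i := proj e (x - x0) 0 (lift j i) / D + 2^-1.
have PB x y i : P x i - P y i = proj e (x - y) 0 (lift j i) / D.
  rewrite /P opprD addrACA subrr addr0 -mulrBl.
  have -> : x - y = (x - x0) - (y - x0) by rewrite opprB subrKA.
  by rewrite [in RHS]projB !mxE.
apply: (@hausdorff_grid_fin _ _ n S P K).
- by rewrite mulr_ge0// addr_ge0// mulr_ge0// mulr_ge0.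
- apply: closedI.
    apply: closedI; first exact: closed_closure.
    by apply: open_closedC; exact: open_interior.
  have -> : [set x | `|x0 - x| <= r] = closed_ball x0 r.
    by rewrite closed_ballE.
  exact: closed_ball_closed.
- move=> i; apply: (@lipschitz_continuous _ _ _ (2 / D)) => x y.
  rewrite PB normrM normfV (gtr0_norm D0) mulrAC ler_wpM2r ?invr_ge0 ?(ltW D0)//.
  exact: coord_proj.
- move=> x i [_ /= xr].
  have h : `|proj e (x - x0) 0 (lift j i) / D| <= 4^-1.
    rewrite normrM normfV (gtr0_norm D0) ler_pdivrMr//.
    apply: (le_trans (coord_proj _ _ e1)).
    have := enorm_le_normr (x - x0); rewrite distrC in xr.
    have : n.+1%:R * `|x - x0| <= n.+1%:R * r :> R by rewrite ler_wpM2l.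
    by rewrite /D -[8 * _ * _]mulrA; move: (n.+1%:R * r) => nr; lra.
  by move: h; rewrite /P ler_norml; lra.
move=> x y r' r'0 [bx /= xr] [by_ /= yr] xy.
have z'r i : `|proj e (x - y) 0 i| <= K1 * r'.
  rewrite /K1 -mulrA; apply: coord_proj_lift => // [|k].
    by rewrite mulr_ge0// ltW.
  have := xy k; rewrite PB normrM normfV (gtr0_norm D0) ler_pdivrMr//.
  by rewrite mulrC.
have gx : phi x = dot x e by apply: graph => //; exact: le_lt_trans rr2.
have gy : phi y = dot y e by apply: graph => //; exact: le_lt_trans rr2.
have ze : `|dot (x - y) e| <= `|L| * (n.+1%:R * (K1 * r')).
  (* On the graph the height is phi, which is invariant along e, so its increment is controlled by
     the projections alone. *)
  rewrite dotBl -gx -gy -(phie x (- dot x e)) -(phie y (- dot y e)).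
  rewrite !scaleNr (le_trans (phiL _ _))//.
  rewrite (le_trans (ler_wpM2r (enorm_ge0 _) (ler_norm L)))// ler_wpM2l//.
  have := projB e x y; rewrite /proj => <-.
  exact: enorm_le_coord.
rewrite /K -mulrA; apply: enorm_le_coord => i.
have -> : (x - y) 0 i = proj e (x - y) 0 i + dot (x - y) e * e 0 i.
  by rewrite /proj !mxE subrK.
rewrite (le_trans (ler_normD _ _))// [leRHS]mulrDl lerD//.
rewrite normrM -2!mulrA (le_trans _ ze)// ler_piMr//.
exact: coord_unit.
Qed.

Lemma hausdorff_bd_fin O (M : R) : lipschitz_boundary O ->
  (forall x, O x -> enorm x <= M) -> (hausdorff n (bd O) < +oo)%E.
Proof.
move=> lipO OM.
have /choice[rad radP] (x : E) : exists r : R, bd O x ->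
    0 < r /\ (hausdorff n (bd O `&` [set y | (`|x - y| <= r)%R]) < +oo)%E.
  have [bx|nbx] := pselect (bd O x); last by exists 0.
  by have [r r0 rfin] := hausdorff_bd_local lipO bx; exists r.
have := compact_bd OM; rewrite compact_cover.
move=> /(_ _ (bd O) (fun x => ball x (rad x))) [||D Dbd cov].
- by move=> x _; exact: ball_open.
- by move=> x bx; exists x => //; apply: ballxx; have [] := radP x bx.
have {}cov : bd O `<=` \big[setU/set0]_(x <- finmap.enum_fset D)
    (bd O `&` [set y | (`|x - y| <= rad x)%R]).
  move=> y by_; have [x xD] := cov y by_.
  rewrite -ball_normE /= => xy; rewrite -bigcup_fset; exists x => //=.
  by split=> //=; exact: ltW.
apply: (le_lt_trans (le_hausdorff n cov)).
rewrite big_seq_cond.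
apply: (big_ind (fun X => hausdorff n X < +oo)%E).
- by rewrite hausdorff0.
- move=> A B Afin Bfin.
  apply: (@le_lt_trans _ _ (hausdorff n A + hausdorff n B)%E).
    exact: (outer_measureU2 (hausdorff n) A B).
  by rewrite lte_add_pinfty.
- move=> x /andP[xD _]; have := radP x; case=> //.
  by have := Dbd _ xD; rewrite inE.
Qed.

End LipschitzBoundary.

(** * Lebesgue measure of boxes *)

Section LebesgueBoxes.
Variable R : realType.

(** The endpoints are indexed by [nat] rather than ['I_d], so that dropping the first coordinate in
    the induction is a shift of indices. *)
Let tbox d (a b : nat -> R) : set (d.-tuple (measurableTypeR R)) :=
  [set t | forall i : 'I_d, `]a i, b i[%classic (tnth t i)].

Let measurable_tbox d a b : measurable (@tbox d a b).
Proof.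
have -> : @tbox d a b = \big[setI/setT]_(i < d)
    ((@tnth _ (measurableTypeR R) ^~ i) @^-1` `]a i, b i[%classic).
  apply/seteqP; split => [t qt|t].
    by apply: (big_ind (fun A : set _ => A t)) => // i _ /=; exact: qt.
  by move=> + i; rewrite (bigD1 i)//= => -[+ _].
apply: bigsetI_measurable => i _; rewrite -[X in measurable X]setTI.
apply: measurable_tnth => //.
Qed.

Let leb_tbox d (a b : nat -> R) : (forall i, a i < b i) ->
  exists2 v : R, 0 < v & leb_tuple R d (@tbox d a b) = v%:E.
Proof.
elim: d a b => [|d ih] a b ab.
  exists 1 => //=; rewrite diracE.
  by rewrite mem_set// => -[].
have [v v0 vE] := ih (fun i => a i.+1) (fun i => b i.+1) (fun i => ab i.+1).
exists (v * (b 0%N - a 0%N)); first by rewrite mulr_gt0// subr_gt0.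
rewrite /= /pushforward.
have -> : (fun x : d.-tuple (measurableTypeR R) * measurableTypeR R =>
     [the d.+1.-tuple (measurableTypeR R) of x.2 :: x.1]) @^-1` @tbox d.+1 a b =
  @tbox d (fun i => a i.+1) (fun i => b i.+1) `*` `]a 0%N, b 0%N[%classic.
  apply/seteqP; split => [[t x] /= tx|[t x] /= [ht hx] i].
    split; last by have := tx ord0; rewrite tnth0.
    by move=> i; have := tx (lift ord0 i); rewrite tnthS.
  by case: (unliftP ord0 i) => [k|] ->; rewrite ?tnthS ?tnth0//; exact: ht.
rewrite product_measure1E//=; last exact: measurable_tbox.
by rewrite [X in (X * _)%E]vE lebesgue_measure_itv/= lte_fin ab EFinM EFinB.
Qed.

(** Sup-norm balls are open boxes. Positivity of the value serves the density argument, finiteness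
    the measure of bounded sets. *)
Lemma leb_box d (c : 'rV[R]_d) (r : R) : 0 < r ->
  exists2 v : R, 0 < v & leb R d (ball c r) = v%:E.
Proof.
move=> r0.
pose a i := (if insub i is Some j then c 0 j else 0) - r.
pose b i := (if insub i is Some j then c 0 j else 0) + r.
have [|v v0 vE] := @leb_tbox d a b.
  by move=> i; rewrite /a /b ltrD2l gtrN.
exists v => //; rewrite -vE /= /pushforward; congr (leb_tuple R d _).
apply/seteqP; split => t /=.
  move=> [_ h] i; have := h 0 i.
  by rewrite mxE /ball /= /a /b valK ltr_distlC in_itv.
move=> h; split => // i j; rewrite (ord1 i) mxE /ball /=.
by have := h j; rewrite /a /b valK /= in_itv/= ltr_distlC.
Qed.

Lemma leb_bounded_fin d (A : set 'rV[R]_d) (M : R) :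
  measurable (A : set (borel R d)) -> (forall x, A x -> `|x| <= M) ->
  (leb R d A < +oo)%E.
Proof.
move=> mA AM; have M0 : 0 < `|M| + 1 by rewrite ltr_wpDl.
have [v v0 vE] := leb_box (0 : 'rV[R]_d) M0.
apply: (@le_lt_trans _ _ (leb R d (ball (0 : 'rV[R]_d) (`|M| + 1)))).
  apply: le_measure; rewrite ?inE//.
    by apply: sub_sigma_algebra; exact: ball_open.
  move=> x Ax; rewrite -ball_normE /= sub0r normrN.
  by rewrite (le_lt_trans (AM _ Ax))// (le_lt_trans (ler_norm M))// ltrDl.
by rewrite vE ltry.
Qed.

(** A ball in U missing P would lie in the exceptional null set, although its measure is
    positive. *)
Lemma ae_leb_closure d (P : 'rV[R]_d -> Prop) (U : set 'rV[R]_d) :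
  open U -> {ae leb R d, forall x, P x} -> U `<=` closure (U `&` P).
Proof.
move=> oU [N [mN N0 PN]] x Ux B Bx.
have /nbhs_rowP[r r0 rUB] : nbhs x (U `&` B).
  by apply: filterI => //; exact: open_nbhs_nbhs.
apply: contrapT => h.
have [v v0 vE] := leb_box x r0.
have : (leb R d (ball x r) <= leb R d N)%E.
  apply: le_measure; rewrite ?inE//.
    by apply: sub_sigma_algebra; exact: ball_open.
  move=> y; rewrite -ball_normE /= => xy; apply: PN => Py.
  by apply: h; exists y; have [] := rUB y xy.
by rewrite vE N0 lee_fin leNgt v0.
Qed.

End LebesgueBoxes.

(** * Polynomials, measurability and integrals of piecewise functions *)

Section PolyFun.
Variables (R : realType) (d k : nat).
Local Notation E := 'rV[R]_d.
Implicit Types (f g : E -> R).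

Lemma poly_fun_cst0 : poly_fun k (fun _ : E => 0).
Proof. by exists (fun=> 0) => x; rewrite big1// => a _; rewrite mul0r. Qed.

Lemma poly_funD f g : poly_fun k f -> poly_fun k g ->
  poly_fun k (fun x => f x + g x).
Proof.
move=> [c fc] [c' gc]; exists (fun a => c a + c' a) => x.
by rewrite fc gc -big_split; apply: eq_bigr => a _; rewrite mulrDl.
Qed.

Lemma poly_funZ (r : R) f : poly_fun k f -> poly_fun k (fun x => r * f x).
Proof.
move=> [c fc]; exists (fun a => r * c a) => x.
by rewrite fc mulr_sumr; apply: eq_bigr => a _; rewrite mulrA.
Qed.

Lemma poly_fun_sum (I : Type) (s : seq I) (P : pred I) (F : I -> E -> R) :
  (forall i, P i -> poly_fun k (F i)) ->
  poly_fun k (fun x => \sum_(i <- s | P i) F i x).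
Proof.
move=> PF; elim: s => [|i s ih].
  under eq_fun do rewrite big_nil; exact: poly_fun_cst0.
under eq_fun do rewrite big_cons.
by case Pi : (P i) => //; apply: poly_funD => //; exact: PF.
Qed.

Lemma poly_fun_monomial (e : 'I_d -> nat) : (\sum_j e j <= k)%N ->
  poly_fun k (fun x : E => \prod_j x 0 j ^+ e j).
Proof.
move=> ek.
have ek1 j : (e j < k.+1)%N.
  by rewrite ltnS (leq_trans _ ek)// (bigD1 j)//= leq_addr.
pose a : {ffun 'I_d -> 'I_k.+1} := [ffun j => Ordinal (ek1 j)].
exists (fun b => (b == a)%:R) => x.
rewrite (bigD1 a)/=; last by rewrite (eq_bigr e)// => j _; rewrite ffunE.
rewrite eqxx mul1r [X in _ + X]big1 ?addr0.
  by apply: eq_bigr => j _; rewrite ffunE.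
by move=> b /andP[_ /negbTE->]; rewrite mul0r.
Qed.

Lemma partial_along (j : 'I_d) f (F : R -> R) (x : E) :
  (forall h, f (h *: delta_mx 0 j + x) = F (h + x 0 j)) ->
  partial j f x = derive1 F (x 0 j).
Proof.
move=> fF; rewrite /partial derive1E /derive; congr (lim (_ @ 0^')).
apply/funext => h /=; congr (_ *: (_ - _)).
  by rewrite fF [h *: 1]mulr1.
by have := fF 0; rewrite scale0r !add0r.
Qed.

(** The degree bound k is kept rather than lowered, so that the trace inequality for degree k
    applies directly to derivatives. *)
Lemma poly_fun_partial (j : 'I_d) f : poly_fun k f -> poly_fun k (partial j f).
Proof.
move=> [c fc].
pose m (a : {ffun 'I_d -> 'I_k.+1}) (x : E) :=
  c a * \prod_(i | i != j) x 0 i ^+ a i.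
(* When [a j] is 0 its predecessor is 0 as well, but the factor [c a *+ a j] then vanishes. *)
have -> : partial j f = fun x =>
    \sum_(a : {ffun 'I_d -> 'I_k.+1} | (\sum_j a j <= k)%N)
      (c a *+ a j) * \prod_i x 0 i ^+ (if i == j then (a i).-1 else a i).
  apply/funext => x.
  (* The restriction of f to the line through x in direction j, as a univariate polynomial in the
     j-th coordinate. *)
  pose p := \sum_(a : {ffun 'I_d -> 'I_k.+1} | (\sum_j a j <= k)%N)
     m a x *: 'X^(a j).
  rewrite (@partial_along _ _ (horner p)) => [|h]; last first.
    rewrite fc horner_sum; apply: eq_bigr => a _.
    rewrite hornerZ hornerXn (bigD1 j)//= /m -mulrA; congr (_ * _).
    rewrite mulrC; congr (_ * _); last by rewrite !mxE !eqxx mulr1.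
    by apply: eq_bigr => i ij; rewrite !mxE eqxx/= (negbTE ij) mulr0 add0r.
  rewrite -derivE raddf_sum horner_sum; apply: eq_bigr => a _.
  rewrite /= derivZ derivXn hornerZ hornerMn hornerXn [in RHS](bigD1 j)//= eqxx.
  rewrite /m -mulrA mulrnAl -mulrnAr; congr (_ * _).
  rewrite mulrC mulrnAl; congr (_ *+ _); congr (_ * _).
  by apply: eq_bigr => i /negbTE ->.
apply: poly_fun_sum => a ak; apply: poly_funZ; apply: poly_fun_monomial.
apply: leq_trans ak; apply: leq_sum => i _.
by case: ifP => // _; exact: leq_pred.
Qed.

Lemma poly_fun_bounded f (M : R) : poly_fun k f ->
  exists B, forall x, `|x| <= M -> `|f x| <= B.
Proof.
move=> [c fc].
exists (\sum_(a : {ffun 'I_d -> 'I_k.+1} | (\sum_j a j <= k)%N)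
  `|c a| * \prod_j M ^+ a j) => x xM.
rewrite fc (le_trans (ler_norm_sum _ _ _))//; apply: ler_sum => a _.
rewrite normrM ler_wpM2l// normr_prod; apply: ler_prod => j _.
rewrite normr_ge0 normrX lerXn2r ?nnegrE ?(le_trans (normr_ge0 _) xM)//.
by rewrite (le_trans _ xM)// coord_le_normr.
Qed.

Lemma poly_fun_continuous f : poly_fun k f -> continuous f.
Proof.
move=> [c fc]; have -> : f = fun x => \sum_(a : {ffun 'I_d -> 'I_k.+1} |
    (\sum_j a j <= k)%N) c a * \prod_j x 0 j ^+ a j by exact/funext.
apply: continuous_big => [|a _ x]; first exact: add_continuous.
apply: continuousM; first exact: cst_continuous.
suff h : continuous (fun y : E => \prod_j y 0 j ^+ a j) by exact: h.
apply: continuous_big => [|j _ y]; first exact: mul_continuous.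
apply: (@continuous_comp _ _ _ (fun x : E => x 0 j) (fun t : R => t ^+ a j)).
  exact: coord_continuous.
exact: exprn_continuous.
Qed.

End PolyFun.

Section BorelMeasurable.
Variables (R : realType) (d : nat).
Local Notation E := 'rV[R]_d.

Lemma within_continuous_measurable (D : set E) (f : E -> R) :
  closed D -> {within D, continuous f} ->
  measurable_fun (D : set (borel R d)) f.
Proof.
move=> cD /continuousP cf.
apply: (measurability _ (RGenOpens.measurableE R)).
move=> _ [_ [a [b ->] <-]].
have /open_subspaceP[V oV VD] : open ((f : subspace D -> R) @^-1` `]a, b[%classic).
  exact/cf/interval_open.
rewrite setIC -VD; apply: measurableI.
  by apply: sub_sigma_algebra.
exact: borel_closed.
Qed.

Lemma poly_fun_measurable k (D : set E) (f : E -> R) : closed D -> poly_fun k f ->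
  measurable_fun (D : set (borel R d)) f.
Proof.
move=> cD fk; apply: within_continuous_measurable => //.
by apply: continuous_subspaceT; exact: poly_fun_continuous fk.
Qed.

Lemma measurable_fun_surface (D : set E) (f : E -> R) :
  measurable (D : set (borel R d)) -> measurable_fun (D : set (borel R d)) f ->
  measurable_fun (D : set (surface_type R d)) f.
Proof.
move=> mD mf _ B mB; apply: borel_measurable_surface.
by apply: mf.
Qed.

End BorelMeasurable.

(** * Bounded measurable functions and functions given piece by piece *)

Section BoundedMeasurable.
Context dT (T : measurableType dT) (R : realType).
Implicit Types (A D : set T) (f g : T -> R).

(** This class is stable under sums and products and integrable on measurable sets of finite
    measure, so integrability conditions reduce to closure properties. *)
Definition bmeas A f := measurable_fun A f /\ exists M : R, forall x, A x -> `|f x| <= M.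

Lemma bmeas_cst A (r : R) : bmeas A (fun=> r).
Proof. by split; [exact: measurable_cst|exists `|r|]. Qed.

Lemma bmeasD A f g : bmeas A f -> bmeas A g -> bmeas A (fun x => f x + g x).
Proof.
move=> [mf [M fM]] [mg [N gN]]; split; first exact: measurable_funD.
exists (M + N) => x Ax; rewrite (le_trans (ler_normD _ _))// lerD//; first exact: fM.
exact: gN.
Qed.

Lemma bmeasM A f g : bmeas A f -> bmeas A g -> bmeas A (fun x => f x * g x).
Proof.
move=> [mf [M fM]] [mg [N gN]]; split; first exact: measurable_funM.
exists (M * N) => x Ax; rewrite normrM ler_pM//; first exact: fM.
exact: gN.
Qed.

Lemma bmeas_sum A (I : Type) (s : seq I) (F : I -> T -> R) :
  (forall i, bmeas A (F i)) -> bmeas A (fun x => \sum_(i <- s) F i x).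
Proof.
move=> mF; elim: s => [|i s ih].
  by under eq_fun do rewrite big_nil; exact: bmeas_cst.
by under eq_fun do rewrite big_cons; exact: bmeasD.
Qed.

Lemma bmeasX A f n : bmeas A f -> bmeas A (fun x => f x ^+ n).
Proof.
move=> mf; elim: n => [|n ih]; first exact: bmeas_cst.
by under eq_fun do rewrite exprS; exact: bmeasM.
Qed.

Lemma bmeasS A B f : measurable B -> A `<=` B -> bmeas B f -> bmeas A f.
Proof.
move=> mB AB [mf [M fM]]; split; first exact: measurable_funS mf.
by exists M => x /AB /fM.
Qed.

Lemma bmeas_le A f g : measurable_fun A f -> bmeas A g ->
  (forall x, A x -> `|f x| <= g x) -> bmeas A f.
Proof.
move=> mf [_ [M gM]] fg; split=> //; exists M => x Ax.
by rewrite (le_trans (fg x Ax))// (le_trans (ler_norm _))// gM.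
Qed.

Variable mu : {measure set T -> \bar R}.

Lemma bmeas_integrable A f : measurable A -> (mu A < +oo)%E -> bmeas A f ->
  mu.-integrable A (EFin \o f).
Proof.
move=> mA Afin [mf [M fM]]; apply: measurable_bounded_integrable => //.
exists M; split; first exact: num_real.
by move=> M' MM' x Ax; apply: (le_trans (fM x Ax)); exact: ltW.
Qed.

Lemma bmeas_Rintegral_sum A (I : Type) (s : seq I) (F : I -> T -> R) :
  measurable A -> (mu A < +oo)%E -> (forall i, bmeas A (F i)) ->
  \int[mu]_(x in A) (\sum_(i <- s) F i x) = \sum_(i <- s) \int[mu]_(x in A) F i x.
Proof.
move=> mA Afin mF; elim: s => [|i s ih].
  rewrite big_nil; under eq_Rintegral do rewrite big_nil.
  by rewrite Rintegral_cst// mul0r.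
rewrite big_cons -ih -RintegralD//; last 2 first.
- exact: bmeas_integrable.
- by apply: bmeas_integrable => //; exact: bmeas_sum.
by apply: eq_Rintegral => x _; rewrite big_cons.
Qed.

Section Pieces.
Variables (n : nat) (sel : T -> option 'I_n) (D : set T).
Hypotheses (mD : measurable D) (Dfin : (mu D < +oo)%E).
Let piece i := D `&` [set x | sel x = Some i].
Hypothesis mpiece : forall i, measurable (piece i).

(** With the selectors [elt_at] and [adj_elt] this is the integrand of [int_Omega] and of
    [int_GammaD]. The fibres of [sel] are disjoint, so on D it is a finite sum of restrictions. *)
Definition pieced (f : 'I_n -> T -> R) x := if sel x is Some i then f i x else 0.

Let piecedE (f : 'I_n -> T -> R) x : D x -> pieced f x = \sum_i (f i \_ (piece i)) x.
Proof.
move=> Dx; rewrite /pieced; case sx : (sel x) => [i|].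
  rewrite (bigD1 i)//= patchE mem_set// big1 ?addr0// => j ji.
  rewrite patchE memNset// => -[_ /=]; rewrite sx => -[ij].
  by move: ji; rewrite ij eqxx.
rewrite big1// => i _; rewrite patchE memNset// => -[_ /=].
by rewrite sx.
Qed.

Let measurable_patch f i : measurable_fun (piece i) f ->
  measurable_fun D (f \_ (piece i)).
Proof. by move=> mf; apply/measurable_restrict => //; rewrite setIA setIid. Qed.

Let bmeas_patch f i : bmeas (piece i) f -> bmeas D (f \_ (piece i)).
Proof.
move=> [mf [M fM]]; split; first exact: measurable_patch.
exists `|M| => x Dx; rewrite patchE; case: ifPn => [|_]; last by rewrite normr0.
by move=> /set_mem /fM /le_trans; apply; exact: ler_norm.
Qed.

Lemma measurable_pieced (f : 'I_n -> T -> R) :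
  (forall i, measurable_fun (piece i) (f i)) -> measurable_fun D (pieced f).
Proof.
move=> mf; have m : measurable_fun D (fun x => \sum_i (f i \_ (piece i)) x).
  by apply: measurable_sum => i; exact: measurable_patch.
by apply: eq_measurable_fun m => x /set_mem Dx; rewrite piecedE.
Qed.

Lemma bmeas_pieced (f : 'I_n -> T -> R) :
  (forall i, bmeas (piece i) (f i)) -> bmeas D (pieced f).
Proof.
move=> mf; split; first by apply: measurable_pieced => i; case: (mf i).
have [_ [M fM]] : bmeas D (fun x => \sum_i (f i \_ (piece i)) x).
  by apply: bmeas_sum => i; exact: bmeas_patch.
by exists M => x Dx; rewrite piecedE// fM.
Qed.

Lemma Rintegral_pieced (f : 'I_n -> T -> R) : (forall i, bmeas (piece i) (f i)) ->
  \int[mu]_(x in D) pieced f x = \sum_i \int[mu]_(x in piece i) f i x.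
Proof.
move=> mf; transitivity (\int[mu]_(x in D) \sum_i (f i \_ (piece i)) x).
  by apply: eq_Rintegral => x /set_mem Dx; rewrite piecedE.
rewrite bmeas_Rintegral_sum//; last by move=> i; exact: bmeas_patch.
apply: eq_bigr => i _; rewrite -Rintegral_mkcondr.
by rewrite setIA setIid.
Qed.

End Pieces.

Lemma bmeas_Rintegral_subset A B f : measurable A -> measurable B -> (mu B < +oo)%E ->
  A `<=` B -> bmeas B f -> (forall x, B x -> 0 <= f x) ->
  \int[mu]_(x in A) f x <= \int[mu]_(x in B) f x.
Proof.
move=> mA mB Bfin AB mf f0.
have -> : A = B `&` A by rewrite setIC; apply/esym/setIidPl.
rewrite Rintegral_mkcondr; apply: le_Rintegral => //.
- apply: bmeas_integrable => //; split.
    apply/measurable_restrict => //.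
    by case: (bmeasS mB (@subIsetl _ _ _) mf : bmeas (B `&` A) f).
  have [_ [M fM]] := mf; exists `|M| => x Bx; rewrite patchE.
  case: ifPn => [_|_]; last by rewrite normr0.
  by rewrite (le_trans (fM x Bx))// ler_norm.
- exact: bmeas_integrable.
- by move=> x Bx; rewrite patchE; case: ifP => // _; exact: f0.
Qed.

Lemma bmeas_le_Rintegral A f g : measurable A -> (mu A < +oo)%E ->
  bmeas A f -> bmeas A g -> (forall x, A x -> f x <= g x) ->
  \int[mu]_(x in A) f x <= \int[mu]_(x in A) g x.
Proof. by move=> mA Afin mf mg; apply: le_Rintegral => //; exact: bmeas_integrable. Qed.

End BoundedMeasurable.

(** * Tangents *)

Lemma Delta2_gt0 (R : realType) (d : nat) (delta : R) (A : 'M[R]_d) :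
  0 < delta -> 0 < Delta2 delta A.
Proof. by move=> delta0; rewrite /Delta2 ltr_wpDr ?sqr_ge0// exprn_gt0. Qed.

Section Viscosity.
Variables (R : realType) (d : nat) (nu_inf nu delta p : R).
Hypotheses (nu_inf0 : 0 < nu_inf) (nu0 : 0 < nu) (delta0 : 0 < delta)
  (p12 : 1 < p < 2).
Implicit Types A B : 'M[R]_d.

Let Delta2_gt0 A : 0 < Delta2 delta A.
Proof. exact: Delta2_gt0. Qed.

Let mu_visc_ge0 A : 0 <= mu_visc nu delta p A.
Proof. by rewrite mulr_ge0 ?powR_ge0// ltW. Qed.

Lemma eta_ge A : nu_inf <= eta nu_inf nu delta p A.
Proof. by rewrite lerDl. Qed.

(** The viscosity [mu_visc] at A = 0, which is its maximum because the exponent (p - 2) / 2 is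
    negative. *)
Let mu0 := nu * (delta ^+ 2) `^ ((p - 2) / 2).

Let mu0_ge0 : 0 <= mu0.
Proof. by rewrite mulr_ge0 ?powR_ge0// ltW. Qed.

Let mu_visc_le A : mu_visc nu delta p A <= mu0.
Proof.
rewrite /mu_visc /mu0 ler_wpM2l ?(ltW nu0)//.
have -> : (p - 2) / 2 = - ((2 - p) / 2) by lra.
rewrite !powRN lef_pV2 ?posrE ?powR_gt0 ?exprn_gt0//.
apply: ge0_ler_powR; rewrite ?nnegrE ?sqr_ge0//.
- by case/andP: p12 => _ p2; rewrite divr_ge0// subr_ge0 ltW.
- exact: ltW.
- by rewrite /Delta2 lerDl sqr_ge0.
Qed.

Lemma eta_bounded : exists M, forall A, `|eta nu_inf nu delta p A| <= M.
Proof.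
exists (nu_inf + mu0) => A; rewrite ger0_norm; last by rewrite addr_ge0// ltW.
by rewrite lerD2l.
Qed.

(** One family covers all cases: s = 0 is Picard, s = 1 is exact Newton and also [DS], and s =
    [clip] is modified Newton. *)
Let T_clip (s : R) A B := eta nu_inf nu delta p A *: B
  + (s * (p - 2) * (mu_visc nu delta p A / Delta2 delta A) * frob A B) *: A.

Let weight_le A :
  0 <= mu_visc nu delta p A / Delta2 delta A /\
  mu_visc nu delta p A / Delta2 delta A * fnorm A ^+ 2 <= mu_visc nu delta p A.
Proof.
split; first by rewrite divr_ge0 ?(ltW (Delta2_gt0 _)).
rewrite mulrAC ler_pdivrMr// ler_wpM2l// /Delta2 lerDr sqr_ge0 //.
Qed.

(** The correction has coefficient -s (2 - p), of size at most 1 because 1 < p < 2. By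
    Cauchy-Schwarz and |A|^2 <= [Delta2] it takes at most m |B|^2 from the form, which the m in
    [eta] compensates, leaving nu_inf. For the norm, each of the two occurrences of m is at most
    [mu0]. *)
Let T_clip_bounds (s : R) A B : 0 <= s <= 1 ->
  nu_inf * fnorm B ^+ 2 <= frob (T_clip s A B) B /\
  fnorm (T_clip s A B) <= (nu_inf + 2 * mu0) * fnorm B.
Proof.
move=> /andP[s0 s1]; have /andP[p1 p2] := p12.
have [w0 wm] := weight_le A; have m0 := mu_visc_ge0 A.
have mm := mu_visc_le A.
rewrite /T_clip /eta.
set m := mu_visc nu delta p A in w0 wm m0 mm *.
set w := m / Delta2 delta A in w0 wm *.
have AB : frob A B ^+ 2 <= fnorm A ^+ 2 * fnorm B ^+ 2.
  rewrite -exprMn -(real_normK (num_real (frob A B))).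
  by rewrite ler_sqr ?nnegrE// ?mulr_ge0 ?fnorm_ge0// normr_frob.
have t01 : 0 <= s * (2 - p) <= 1.
  by apply/andP; split; [apply: mulr_ge0 => //; lra|nra].
split.
  rewrite frobDl !frobZl -fnorm_sqr.
  have h1 : w * frob A B ^+ 2 <= m * fnorm B ^+ 2.
    apply: (@le_trans _ _ (w * (fnorm A ^+ 2 * fnorm B ^+ 2))).
      by rewrite ler_wpM2l.
    by rewrite mulrA ler_wpM2r ?sqr_ge0.
  have h2 : s * (2 - p) * (w * frob A B ^+ 2) <= m * fnorm B ^+ 2.
    have /andP[t0 t1] := t01.
    by rewrite (le_trans _ h1)// ler_piMl// mulr_ge0// sqr_ge0.
  have -> : s * (p - 2) * w * frob A B * frob A B =
      - (s * (2 - p) * (w * frob A B ^+ 2)) by ring.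
  by rewrite mulrDl; lra.
rewrite (le_trans (fnorm_triangle _ _))// !fnormZ.
have -> : `|nu_inf + m| = nu_inf + m by rewrite ger0_norm// addr_ge0// ltW.
have h : `|s * (p - 2) * w * frob A B| * fnorm A <= m * fnorm B.
  have -> : s * (p - 2) * w * frob A B = - (s * (2 - p) * w * frob A B) by ring.
  have /andP[t0 t1] := t01.
  rewrite normrN 2!normrM (ger0_norm t0) (ger0_norm w0).
  apply: (@le_trans _ _ (1 * w * (fnorm A * fnorm B) * fnorm A)).
    rewrite ler_wpM2r ?fnorm_ge0//; apply: ler_pM => //.
    - exact: mulr_ge0.
    - exact: ler_wpM2r.
    - exact: normr_frob.
  have -> : 1 * w * (fnorm A * fnorm B) * fnorm A = w * fnorm A ^+ 2 * fnorm B by ring.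
  by rewrite ler_wpM2r ?fnorm_ge0.
have B0 := fnorm_ge0 B.
have : m * fnorm B <= mu0 * fnorm B by rewrite ler_wpM2r.
by rewrite !mulrDl; lra.
Qed.

Let DSE A B : DS nu_inf nu delta p A B = T_clip 1 A B.
Proof.
rewrite /DS /T_clip mul1r; congr (_ + (_ * _) *: _).
rewrite /mu_visc mulrCA -[in RHS]mulrA.
have -> : (p - 4) / 2 = (p - 2) / 2 + - 1 by lra.
rewrite powRD; last by apply/implyP => _; rewrite gt_eqF.
rewrite powRN powRr1; last exact: ltW.
by rewrite -!mulrA; congr (_ * _); rewrite mulrCA.
Qed.

Let T_exNE A B : T_exN nu_inf nu delta p A B = T_clip 1 A B.
Proof. by rewrite /T_exN /T_clip mul1r. Qed.

Let T_PicE A B : T_Pic nu_inf nu delta p A B = T_clip 0 A B.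
Proof. by rewrite /T_Pic /T_clip !mul0r scale0r addr0. Qed.

Let clip01 sigma_max A : 0 < sigma_max -> 0 <= clip nu delta p sigma_max A <= 1.
Proof.
move=> s0; rewrite /clip; case: ifP => _; first by rewrite lexx ler01.
by rewrite ge_min lexx andbT le_min ler01 divr_ge0 ?fnorm_ge0// ltW.
Qed.

Lemma three_tangents_bounded (G : domain R d) (Th : mesh G) (Dg A : field Th 'M[R]_d) :
  let bounded_tangent T := exists2 eta_bar, nu_inf <= eta_bar &
    tangent_bounds nu_inf nu delta p T Dg eta_bar in
  [/\ bounded_tangent (fun i x => T_Pic nu_inf nu delta p (A i x)),
      bounded_tangent (fun i x => T_exN nu_inf nu delta p (A i x)) &
      forall sigma_max, 0 < sigma_max -> bounded_tangent
        (fun i x => T_modN nu_inf nu delta p sigma_max (A i x))].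
Proof.
move=> bounded_tangent.
have main (T : field Th ('M[R]_d -> 'M[R]_d)) : (forall i x, exists2 s, 0 <= s <= 1 &
    forall B, T i x B = T_clip s (A i x) B) -> bounded_tangent T.
  (* The factor 2 is there because the bound concerns the sum of |T B| and |DS B|, two members of
     the same family. *)
  move=> Ts; exists (2 * (nu_inf + 2 * mu0)).
    by have := mu0_ge0; have := nu_inf0; lra.
  apply: aeW => x i _ B _; have [s s01 ->] := Ts i x.
  have [coer bnd] := T_clip_bounds (A i x) B s01; split=> //.
  have s11 : 0 <= (1 : R) <= 1 by rewrite ler01 lexx.
  have [_] := T_clip_bounds (Dg i x) B s11; rewrite -DSE.
  by rewrite -mulrA; lra.
split.
- apply: main => i x; exists 0; first by rewrite lexx ler01.
  by move=> B; exact: T_PicE.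
- apply: main => i x; exists 1; first by rewrite lexx ler01.
  by move=> B; exact: T_exNE.
- move=> s s0; apply: main => i x; exists (clip nu delta p s (A i x)) => //.
  exact: clip01.
Qed.

Lemma continuous_frob B : continuous (fun A => frob A B).
Proof.
rewrite /frob; apply: continuous_big => [|i _]; first exact: add_continuous.
apply: continuous_big => [|j _ A]; first exact: add_continuous.
apply: continuousM; first exact: coord_continuous.
exact: cst_continuous.
Qed.

Lemma continuous_fnorm : continuous (fun A => fnorm A).
Proof.
move=> A; apply: (@continuous_comp _ _ _ (fun A => frob A A) (@Num.sqrt R)); last first.
  exact: sqrt_continuous.
suff h : continuous (fun A => frob A A) by exact: h.
rewrite /frob; apply: continuous_big => [|i _]; first exact: add_continuous.
apply: continuous_big => [|j _ A']; first exact: add_continuous.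
by apply: continuousM; exact: coord_continuous.
Qed.

End Viscosity.

(** * Continuity of the stress law and passage to closures *)

Section Regularity.
Variables (R : realType) (d : nat) (nu_inf nu delta p : R).
Hypothesis (delta0 : 0 < delta).
Implicit Types A B : 'M[R]_d.

(** Since delta > 0 the base stays positive, where any real power is differentiable. *)
Lemma continuous_powR_Delta2 (r : R) :
  continuous (fun A : 'M[R]_d => Delta2 delta A `^ r).
Proof.
move=> A; apply: (@continuous_comp _ _ _ (@Delta2 R d delta) (fun t => t `^ r)).
  apply: (@cvgD _ _ _ _ (nbhs_filter (A : 'M[R]_d))); first exact: cvg_cst.
  apply: (@continuous_comp _ _ _ (@fnorm R d) (fun t : R => t ^+ 2)).
    exact: continuous_fnorm.
  exact: exprn_continuous.
apply/differentiable_continuous/derivable1_diffP.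
by apply: derivable_powR; rewrite in_itv/= andbT Delta2_gt0.
Qed.

Lemma continuous_DS B : continuous (fun A => DS nu_inf nu delta p A B).
Proof.
move=> A; have FA := nbhs_filter (A : 'M[R]_d).
apply: (@cvgD _ _ _ _ FA).
  apply: (@cvgZr_tmp _ _ _ _ FA).
  apply: (@cvgD _ _ _ _ FA); first exact: cvg_cst.
  apply: (@cvgM _ _ _ FA); first exact: cvg_cst.
  exact: continuous_powR_Delta2.
apply: (@cvgZ _ _ _ _ FA); last exact: cvg_id.
apply: (@cvgM _ _ _ FA); last exact: continuous_frob.
apply: (@cvgM _ _ _ FA); first exact: cvg_cst.
exact: continuous_powR_Delta2.
Qed.

Lemma continuous_eta : continuous (@eta R d nu_inf nu delta p).
Proof.
move=> A; have FA := nbhs_filter (A : 'M[R]_d).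
apply: (@cvgD _ _ _ _ FA); first exact: cvg_cst.
apply: (@cvgM _ _ _ FA); first exact: cvg_cst.
exact: continuous_powR_Delta2.
Qed.

Lemma within_closure_le (E := 'rV[R]_d) (D U P : set E) (F : E -> R) (c : R) :
  {within D, continuous F} -> U `<=` D -> U `<=` closure (U `&` P) ->
  (forall x, U x -> P x -> F x <= c) ->
  forall x, D x -> closure U x -> F x <= c.
Proof.
move=> cF UD UP Fc x Dx clx; rewrite leNgt; apply/negP => cFx.
have nx : \forall y \near x, D y -> c < F y.
  have := cF x; rewrite /continuous_at /= => /(_ [set t | c < t]).
  move=> /(_ (open_nbhs_nbhs (conj (@open_gt _ c) cFx))).
  by rewrite nbhs_simpl /= -[X in X _ -> _](nbhs_subspace_in Dx).
have UPx : closure (U `&` P) x.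
  have /closure_id -> := @closed_closure _ (U `&` P).
  exact: closureS clx.
have := UPx _ nx; move=> {UPx} [y [[Uy Py] /(_ (UD _ Uy))]].
by rewrite ltNge Fc.
Qed.

End Regularity.

(** * The tangent on closed elements *)

Section TangentOnElements.
Variables (R : realType) (d : nat) (G : domain R d) (Th : mesh G).
Variables (nu_inf nu delta p : R) (delta0 : 0 < delta).
Variables (gD ghat : 'rV[R]_d -> 'rV[R]_d) (Dg : field Th 'M[R]_d).
Hypothesis lift_g : lifting gD ghat Dg.
Variables (T : field Th ('M[R]_d -> 'M[R]_d)) (eta_bar : R).
Hypotheses (Tfield : tangent_field T)
  (Tbounds : tangent_bounds nu_inf nu delta p T Dg eta_bar).
Local Notation E := 'rV[R]_d.

Lemma closed_elt i : closed (@elt _ _ _ Th i).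
Proof. by rewrite elt_regular; exact: closed_closure. Qed.

(** For fixed B both quantities are continuous on the closed element, and the points where the
    bounds hold are dense in it. This makes the bounds available on GammaD. *)
Lemma tangent_bounds_elt i x B : elt i x -> sym_mx B ->
  nu_inf * fnorm B ^+ 2 <= frob (T i x B) B /\
  fnorm (T i x B) + fnorm (DS nu_inf nu delta p (Dg i x) B) <= eta_bar * fnorm B.
Proof.
move=> xi sB.
have cT : {within elt i, continuous (fun y => T i y B)} by exact: (Tfield i).2.
have [_ _ _ cDg] := lift_g.
pose P := [set y | forall i, (elt i)° y -> forall B, sym_mx B ->
     nu_inf * fnorm B ^+ 2 <= frob (T i y B) B /\
     fnorm (T i y B) + fnorm (DS nu_inf nu delta p (Dg i y) B) <= eta_bar * fnorm B].
have UP : (elt i)° `<=` closure ((elt i)° `&` P).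
  by apply: ae_leb_closure => //; exact: open_interior.
have clx : closure (elt i)° x by rewrite -elt_regular.
split.
  rewrite -lerN2.
  apply: (within_closure_le _ _ UP _ xi clx (F := fun y => - frob (T i y B) B)).
  - move=> y; apply: (@cvgN _ _ _ _ (nbhs_filter (y : subspace (elt i)))).
    apply: (@continuous_comp (subspace (elt i)) _ _ (fun y => T i y B) (fun A => frob A B)).
      exact: cT.
    exact: continuous_frob.
  - exact: interior_subset.
  - by move=> y yi /(_ i yi B sB)[h _]; rewrite lerN2.
apply: (within_closure_le _ _ UP _ xi clx (F := fun y =>
  fnorm (T i y B) + fnorm (DS nu_inf nu delta p (Dg i y) B))).
- move=> y; apply: (@cvgD _ _ _ _ (nbhs_filter (y : subspace (elt i)))).
    apply: (@continuous_comp (subspace (elt i)) _ _ (fun y => T i y B) (@fnorm R d)).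
      exact: cT.
    exact: continuous_fnorm.
  apply: (@continuous_comp (subspace (elt i)) _ _ (Dg i)
    (fun A => fnorm (DS nu_inf nu delta p A B))); first exact: cDg.
  apply: (@continuous_comp _ _ _ (fun A => DS nu_inf nu delta p A B) (@fnorm R d)).
    exact: continuous_DS.
  exact: continuous_fnorm.
- exact: interior_subset.
- by move=> y yi /(_ i yi B sB)[].
Qed.

(** Symmetrized elementary matrices, since the linearity of [T] is assumed on symmetric matrices. *)
Let S a b : 'M[R]_d := sym_part (delta_mx a b).

Lemma sym_part_sym (A : 'M[R]_d) : sym_mx (sym_part A).
Proof. by rewrite /sym_mx /sym_part linearZ /= raddfD /= trmxK addrC. Qed.

Lemma sym_part_id (A : 'M[R]_d) : sym_mx A -> sym_part A = A.
Proof.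
rewrite /sym_mx /sym_part => ->; rewrite -mulr2n -[A *+ 2]scaler_nat scalerA.
by rewrite mulVf ?scale1r// pnatr_eq0.
Qed.

Let sym_expand B : sym_mx B -> B = \sum_a \sum_b B a b *: S a b.
Proof.
move=> sB; rewrite -[LHS]sym_part_id// {1}(matrix_sum_delta B).
rewrite /S /sym_part.
transitivity (2^-1 *: \sum_a \sum_b (B a b *: (delta_mx a b + (delta_mx a b)^T))).
  congr (_ *: _); rewrite raddf_sum -big_split; apply: eq_bigr => a _ /=.
  rewrite raddf_sum -big_split; apply: eq_bigr => b _ /=.
  by rewrite scalerDr linearZ.
rewrite scaler_sumr; apply: eq_bigr => a _; rewrite scaler_sumr.
by apply: eq_bigr => b _; rewrite !scalerA mulrC.
Qed.

(** In [T i x (W x)] both the map and its argument vary with x. The expansion separates them into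
    products of entries of [W x] and of functions continuous on the element, which gives
    measurability. *)
Lemma tangent_expand i x B : elt i x -> sym_mx B ->
  T i x B = \sum_a \sum_b B a b *: T i x (S a b).
Proof.
move=> xi sB; have [_ TL] := (Tfield i).1 x xi.
have s0 : sym_mx (0 : 'M[R]_d) by rewrite /sym_mx trmx0.
have T0 : T i x 0 = 0.
  by have := TL 1 0 0 s0 s0; rewrite !scale1r addr0 => /eqP; rewrite -subr_eq0 opprD addNKr oppr_eq0 => /eqP.
rewrite {1}(sym_expand sB) !pair_bigA /=.
(* Additivity of [T] asks for symmetric arguments, so the induction also carries the symmetry of the
   partial sums. *)
suff h (s : seq ('I_d * 'I_d)) : sym_mx (\sum_(ab <- s) B ab.1 ab.2 *: S ab.1 ab.2) /\
    T i x (\sum_(ab <- s) B ab.1 ab.2 *: S ab.1 ab.2) =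
    \sum_(ab <- s) B ab.1 ab.2 *: T i x (S ab.1 ab.2) by exact: (h _).2.
elim: s => [|ab s [sS TS]]; first by rewrite !big_nil.
rewrite !big_cons; split; last by rewrite TL ?TS//; exact: sym_part_sym.
rewrite /sym_mx raddfD /= linearZ /=; congr (_ *: _ + _) => //.
exact: sym_part_sym.
Qed.

Let measurable_within (i : 'I_(nelt Th)) (f : E -> R) : {within elt i, continuous f} ->
  measurable_fun (elt i : set (borel R d)) f.
Proof. by apply: within_continuous_measurable; exact: closed_elt. Qed.

Lemma measurable_tangent (i : 'I_(nelt Th)) (W : E -> 'M[R]_d) a b : (forall x, sym_mx (W x)) ->
  (forall a b, measurable_fun (elt i : set (borel R d)) (fun x => W x a b)) ->
  measurable_fun (elt i : set (borel R d)) (fun x => T i x (W x) a b).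
Proof.
move=> sW mW.
have m : measurable_fun (elt i : set (borel R d))
    (fun x => \sum_(a' : 'I_d) \sum_(b' : 'I_d) W x a' b' * T i x (S a' b') a b).
  apply: measurable_sum => a'; apply: measurable_sum => b'.
  apply: measurable_funM => //; apply: measurable_within => x.
  apply: (@continuous_comp (subspace (elt i)) _ _ (fun y => T i y (S a' b'))
    (fun A : 'M[R]_d => A a b)); last exact: coord_continuous.
  by apply: (Tfield i).2; exact: sym_part_sym.
apply: eq_measurable_fun m => x /set_mem xi.
rewrite [in RHS]tangent_expand// summxE; apply: eq_bigr => a' _.
by rewrite summxE; apply: eq_bigr => b' _; rewrite mxE.
Qed.

Let measurable_Dg (i : 'I_(nelt Th)) a b : measurable_fun (elt i : set (borel R d)) (fun x => Dg i x a b).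
Proof.
have [_ _ _ cDg] := lift_g.
apply: measurable_within => x.
apply: (@continuous_comp (subspace (elt i)) _ _ (Dg i) (fun A : 'M[R]_d => A a b)).
  exact: cDg.
exact: coord_continuous.
Qed.

Lemma measurable_eta (i : 'I_(nelt Th)) :
  measurable_fun (elt i : set (borel R d)) (fun x => eta nu_inf nu delta p (Dg i x)).
Proof.
have [_ _ _ cDg] := lift_g.
apply: measurable_within => x.
apply: (@continuous_comp (subspace (elt i)) _ _ (Dg i) (@eta R d nu_inf nu delta p)).
  exact: cDg.
exact: continuous_eta.
Qed.

Lemma measurable_DS (i : 'I_(nelt Th)) (W : E -> 'M[R]_d) a b :
  (forall a b, measurable_fun (elt i : set (borel R d)) (fun x => W x a b)) ->
  measurable_fun (elt i : set (borel R d))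
    (fun x => DS nu_inf nu delta p (Dg i x) (W x) a b).
Proof.
move=> mW; have [_ _ _ cDg] := lift_g.
rewrite /DS; under eq_fun do rewrite mxE mxE [X in _ + X]mxE.
apply: measurable_funD; apply: measurable_funM => //; first exact: measurable_eta.
apply: measurable_funM.
  apply: measurable_funM; first exact: measurable_cst.
  apply: measurable_within => x.
  apply: (@continuous_comp (subspace (elt i)) _ _ (Dg i)
    (fun A : 'M[R]_d => Delta2 delta A `^ ((p - 4) / 2))); first exact: cDg.
  exact: continuous_powR_Delta2.
apply: measurable_sum => a'; apply: measurable_sum => b'.
exact: measurable_funM.
Qed.

End TangentOnElements.

(** * Integrals over the mesh *)

Section MeshFacts.
Variables (R : realType) (d : nat) (d_gt0 : (0 < d)%N) (G : domain R d) (Th : mesh G).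
Local Notation E := 'rV[R]_d.
Local Notation elt := (@elt R d G Th).

Lemma open_Omega : open (Omega G).
Proof. by have [] := Omega_lipschitz G. Qed.

Lemma measurable_Omega : measurable (Omega G : set (borel R d)).
Proof. by apply: sub_sigma_algebra; exact: open_Omega. Qed.

Lemma bounded_closure_Omega : exists M : R, forall x, closure (Omega G) x -> `|x| <= M.
Proof.
have [_ _ _ [M OM] _] := Omega_lipschitz G.
by exists M; exact: closure_bounded.
Qed.

Lemma leb_Omega_fin : (leb R d (Omega G) < +oo)%E.
Proof.
have [M OM] := bounded_closure_Omega.
apply: (@leb_bounded_fin _ _ _ M) => [|x Ox]; first exact: measurable_Omega.
by apply: OM; exact: subset_closure.
Qed.

Lemma elt_sub_closure i : elt i `<=` closure (Omega G).
Proof. by move=> x xi; rewrite (elt_cover Th); exists i. Qed.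

Lemma bounded_elt : exists M : R, forall i x, elt i x -> `|x| <= M.
Proof.
have [M OM] := bounded_closure_Omega.
by exists M => i x /elt_sub_closure /OM.
Qed.

Lemma elt_interior_sub i : (elt i)° `<=` Omega G.
Proof.
move=> x xi; have [oO _ _ _ lipO] := Omega_lipschitz G.
apply: (interior_closure_lipschitz oO lipO).
by apply: interiorS xi; exact: elt_sub_closure.
Qed.

Lemma measurable_elt i : measurable (elt i : set (borel R d)).
Proof. by apply: borel_closed; exact: closed_elt. Qed.

Lemma measurable_elt_interior i : measurable ((elt i)° : set (borel R d)).
Proof. by apply: sub_sigma_algebra; exact: open_interior. Qed.

Lemma elt_atP x i : elt_at Th x = Some i <-> (elt i)° x.
Proof.
rewrite /elt_at; case: pickP => [j /asboolP xj|h]; last first.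
  by split=> // xi; have /asboolP := h i.
split=> [[<-]//|xi]; congr Some; apply/eqP/negPn/negP => ji.
by have := elt_disjoint ji; rewrite -subset0 => /(_ x); apply.
Qed.

Lemma Omega_piece i :
  Omega G `&` [set x | elt_at Th x = Some i] = (elt i)°.
Proof.
apply/seteqP; split=> [x [_ /= /elt_atP]//|x xi]; split; last exact/elt_atP.
exact: elt_interior_sub xi.
Qed.

(** As [diam] is [fine] of an extended real, it would be 0 for an infinite diameter: positivity
    takes both two distinct points and boundedness. *)
Lemma hsize_gt0 (i : 'I_(nelt Th)) : 0 < hsize i.
Proof.
have [M EM] := bounded_elt.
have [_ _ [x xi] _ _] := elt_lipschitz i.
have /nbhs_rowP[r r0 rU] : nbhs x (elt i)° by apply: open_nbhs_nbhs; split=> //; exact: open_interior.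
pose j : 'I_d := Ordinal d_gt0.
pose y : E := x + (r / 2) *: delta_mx 0 j.
have nd : enorm (x - y) = r / 2.
  rewrite /y opprD addrA subrr add0r /enorm /dot (bigD1 j)//= big1 => [|l lj].
    rewrite !mxE !eqxx mulr1 addr0 mulrNN -expr2 sqrtr_sqr ger0_norm//.
    by rewrite divr_ge0// ltW.
  by rewrite !mxE eqxx/= (negbTE lj) mulr0 oppr0 mul0r.
have ey : elt i y.
  apply: interior_subset; apply: rU.
  rewrite (le_lt_trans (normr_le_enorm _))// nd ltr_pdivrMr// ltr_pMr//.
  by rewrite ltr1n.
have ex : elt i x by exact: interior_subset.
have dge := enorm_le_ediam ex ey; rewrite nd in dge.
have M0 : 0 <= M by rewrite (le_trans _ (EM _ _ ex)).
have dle : (ediam (elt i) <= (d%:R * (M + M))%:E)%E.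
  apply: ediam_le; first by rewrite mulr_ge0// addr_ge0.
  move=> u w ui wi; rewrite (le_trans (enorm_le_normr _))// ler_wpM2l//.
  by rewrite (le_trans (ler_normB _ _))// lerD ?(EM _ _ ui) ?(EM _ _ wi).
rewrite /hsize /diam fine_gt0//; apply/andP; split.
  by rewrite (lt_le_trans _ dge)// lte_fin divr_gt0.
by rewrite (le_lt_trans dle)// ltry.
Qed.

Lemma GammaD_sub_bd : GammaD G `<=` bd (Omega G).
Proof. by rewrite (bd_Omega G); exact: subsetUl. Qed.

Lemma surf_GammaD_fin : (surf R d (GammaD G) < +oo)%E.
Proof.
have [oO _ _ [M OM] lipO] := Omega_lipschitz G.
apply: (@le_lt_trans _ _ (hausdorff d.-1 (bd (Omega G)))).
  exact: (le_hausdorff d.-1 GammaD_sub_bd).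
case: d d_gt0 (Omega G) lipO OM => // n _ O lipO OM.
exact: hausdorff_bd_fin lipO OM.
Qed.

Lemma measurable_GammaD_elt i :
  measurable (GammaD G `&` elt i : set (surface_type R d)).
Proof.
apply: measurableI; first exact: measurable_GammaD.
by apply: borel_measurable_surface; exact: measurable_elt.
Qed.

(** A boundary point may belong to several closed elements, of which [pick] keeps one: the pieces
    are disjoint, each possibly smaller than the part of GammaD in [elt i]. *)
Let adj_piece i := GammaD G `&` [set x | adj_elt Th x = Some i].

Lemma measurable_adj_piece i :
  measurable (adj_piece i : set (surface_type R d)).
Proof.
apply: measurableI; first exact: measurable_GammaD.
(* The selected index depends only on the set s of elements containing x, and each s is attained on
   a finite Boolean combination of closed elements. *)
pose F (s : {set 'I_(nelt Th)}) : set (surface_type R d) :=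
  if [pick j in s] == Some i then
    \big[setI/setT]_j (if j \in s then elt j else ~` elt j) else set0.
have -> : [set x | adj_elt Th x = Some i] = \bigcup_s F s.
  apply/seteqP; split=> [x /= xi|x [s _]].
    exists [set j | `[< elt j x >]]%SET => //; rewrite /F.
    have -> : [pick j in [set j | `[< elt j x >]]%SET] = Some i.
      by rewrite -xi; apply: eq_pick => j; rewrite /= inE.
    rewrite eqxx; apply: (big_ind (fun A : set _ => A x)) => // j _.
    by rewrite inE; case: asboolP.
  rewrite /F; case: eqP => // si Fx /=; rewrite -si; apply: eq_pick => j /=.
  move: Fx; rewrite (bigD1 j)//= => -[+ _].
  by case: ifP => js; [move=> h; apply/asboolP|move=> h; apply/asboolP].
apply: countable_bigcupT_measurable => [|s]; first exact: countableP.
rewrite /F; case: ifP => // _; apply: bigsetI_measurable => j _.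
have mj : measurable (elt j : set (surface_type R d)).
  by apply: borel_measurable_surface; exact: measurable_elt.
by case: ifP => // _; exact: measurableC.
Qed.

Lemma adj_piece_sub i : adj_piece i `<=` GammaD G `&` elt i.
Proof.
move=> x [Gx /=]; rewrite /adj_elt; case: pickP => // j /asboolP xj [<-].
by split.
Qed.

Implicit Types (f g : field Th R).

(** Asked on the closed elements, so that it serves both the integrals over their interiors and the
    traces on GammaD. *)
Definition bmeas_Omega f := forall i, bmeas (elt i : set (borel R d)) (f i).

Definition bmeas_GammaD f :=
  forall i, bmeas (GammaD G `&` elt i : set (surface_type R d)) (f i).

Lemma bmeas_Omega_GammaD f : bmeas_Omega f -> bmeas_GammaD f.
Proof.
move=> mf i; have [m b] := mf i.
apply: (@bmeasS _ _ _ _ (elt i : set (surface_type R d))).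
- by apply: borel_measurable_surface; exact: measurable_elt.
- exact: subIsetr.
- by split=> //; apply: measurable_fun_surface => //; exact: measurable_elt.
Qed.

Let bmeas_int f i : bmeas_Omega f -> bmeas ((elt i)° : set (borel R d)) (f i).
Proof.
move=> mf; apply: bmeasS (mf i); first exact: measurable_elt.
exact: interior_subset.
Qed.

Let bmeas_adj f i : bmeas_GammaD f -> bmeas (adj_piece i : set (surface_type R d)) (f i).
Proof.
move=> mf; apply: bmeasS (mf i); first exact: measurable_GammaD_elt.
exact: adj_piece_sub.
Qed.

Lemma int_Omega_sum f : bmeas_Omega f ->
  int_Omega f = \sum_i \int[leb R d]_(x in (elt i)°) f i x.
Proof.
move=> mf; rewrite /int_Omega.
rewrite (@Rintegral_pieced _ (borel R d) R (leb R d) _ (@elt_at R d G Th) (Omega G)).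
- by apply: eq_bigr => i _; rewrite Omega_piece.
- exact: measurable_Omega.
- exact: leb_Omega_fin.
- by move=> i; rewrite Omega_piece; exact: measurable_elt_interior.
- by move=> i; rewrite Omega_piece; exact: bmeas_int.
Qed.

Lemma bmeas_glued_GammaD f : bmeas_GammaD f ->
  bmeas (GammaD G : set (surface_type R d)) (@pieced _ (surface_type R d) R _ (@adj_elt R d G Th) f).
Proof.
move=> mf; apply: bmeas_pieced => //.
- exact: measurable_GammaD.
- exact: measurable_adj_piece.
- by move=> i; exact: bmeas_adj.
Qed.

Lemma leb_elt_fin i : (leb R d (elt i)° < +oo)%E.
Proof.
apply: le_lt_trans leb_Omega_fin; apply: le_measure; rewrite ?inE.
- exact: measurable_elt_interior.
- exact: measurable_Omega.
- exact: elt_interior_sub.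
Qed.

Lemma int_GammaD_sum f : bmeas_GammaD f ->
  int_GammaD f = \sum_i \int[surf R d]_(x in adj_piece i) f i x.
Proof.
move=> mf; rewrite /int_GammaD.
rewrite (@Rintegral_pieced _ (surface_type R d) R (surf R d) _ (@adj_elt R d G Th) (GammaD G))//.
- exact: measurable_GammaD.
- exact: surf_GammaD_fin.
- exact: measurable_adj_piece.
- by move=> i; exact: bmeas_adj.
Qed.

Lemma le_int_Omega f g : bmeas_Omega f -> bmeas_Omega g ->
  (forall i x, elt i x -> f i x <= g i x) -> int_Omega f <= int_Omega g.
Proof.
move=> mf mg fg; rewrite !int_Omega_sum//; apply: ler_sum => i _.
apply: bmeas_le_Rintegral.
- exact: measurable_elt_interior.
- exact: leb_elt_fin.
- exact: bmeas_int.
- exact: bmeas_int.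
- by move=> x /interior_subset; exact: fg.
Qed.

Lemma int_OmegaZ f (r : R) : bmeas_Omega f ->
  int_Omega (fun i x => r * f i x) = r * int_Omega f.
Proof.
move=> mf; rewrite !int_Omega_sum//; last by move=> i; apply: bmeasM => //; exact: bmeas_cst.
rewrite mulr_sumr; apply: eq_bigr => i _; rewrite RintegralZl//.
  exact: measurable_elt_interior.
apply: bmeas_integrable; [exact: measurable_elt_interior|exact: leb_elt_fin|].
exact: bmeas_int.
Qed.

Let int_glued f : bmeas_GammaD f ->
  (surf R d).-integrable (GammaD G) (EFin \o @pieced _ (surface_type R d) R _ (@adj_elt R d G Th) f).
Proof.
move=> mf; apply: bmeas_integrable.
- exact: measurable_GammaD.
- exact: surf_GammaD_fin.
- exact: bmeas_glued_GammaD.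
Qed.

Lemma le_int_GammaD f g : bmeas_GammaD f -> bmeas_GammaD g ->
  (forall i x, GammaD G x -> elt i x -> f i x <= g i x) ->
  int_GammaD f <= int_GammaD g.
Proof.
move=> mf mg fg; apply: (@le_Rintegral _ _ _ (surf R d)).
- exact: measurable_GammaD.
- exact: int_glued.
- exact: int_glued.
move=> x Gx; case sx : (adj_elt Th x) => [i|//].
by have [] := @adj_piece_sub i x (conj Gx sx); exact: fg.
Qed.

Lemma int_GammaDD f g : bmeas_GammaD f -> bmeas_GammaD g ->
  int_GammaD (fun i x => f i x + g i x) = int_GammaD f + int_GammaD g.
Proof.
move=> mf mg; rewrite /int_GammaD -(@RintegralD _ _ _ (surf R d)).
- by apply: eq_Rintegral => x _; case: (adj_elt Th x) => // ; rewrite addr0.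
- exact: measurable_GammaD.
- exact: int_glued.
- exact: int_glued.
Qed.

Lemma int_GammaDZ f (r : R) : bmeas_GammaD f ->
  int_GammaD (fun i x => r * f i x) = r * int_GammaD f.
Proof.
move=> mf; rewrite /int_GammaD -(@RintegralZl _ _ _ (surf R d)).
- by apply: eq_Rintegral => x _; case: (adj_elt Th x) => // ; rewrite mulr0.
- exact: measurable_GammaD.
- exact: int_glued.
Qed.

Lemma eq_int_GammaD f g : (forall i x, GammaD G x -> elt i x -> f i x = g i x) ->
  int_GammaD f = int_GammaD g.
Proof.
move=> fg; apply: eq_Rintegral => x /set_mem Gx.
case sx : (adj_elt Th x) => [i|//].
by have [] := @adj_piece_sub i x (conj Gx sx); exact: fg.
Qed.

End MeshFacts.

(** * Boundary integrals, the normal and the trace inequality *)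

Section Traces.
Variables (R : realType) (d : nat) (d_gt0 : (0 < d)%N) (G : domain R d) (Th : mesh G).
Local Notation E := 'rV[R]_d.
Local Notation elt := (@elt R d G Th).
Variables (k : nat) (v : field Th E).
Hypothesis v_poly : forall i j, poly_fun k (fun x => v i x 0 j).

Definition measurable_GammaD_field (f : field Th R) :=
  forall i, measurable_fun (GammaD G `&` elt i : set (surface_type R d)) (f i).

(** Meant for replacing the normal. It is stated for measurable fields because integrands with
    [normal G] may be unbounded on the exceptional null set. *)
Lemma ae_eq_int_GammaD (f g : field Th R) :
  measurable_GammaD_field f -> measurable_GammaD_field g ->
  {ae surf R d, forall x, GammaD G x -> forall i, f i x = g i x} ->
  int_GammaD f = int_GammaD g.
Proof.
move=> mf mg fg.
have mpieced h : measurable_GammaD_field h -> measurable_fun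
    (GammaD G : set (surface_type R d))
    (EFin \o @pieced _ (surface_type R d) R _ (@adj_elt R d G Th) h).
  move=> mh; apply/measurable_EFinP; apply: measurable_pieced.
  - exact: measurable_GammaD.
  - exact: measurable_adj_piece.
  - move=> i; apply: measurable_funS (mh i); first exact: measurable_GammaD_elt.
    exact: adj_piece_sub.
congr fine; apply: (@ae_eq_integral _ (surface_type R d) R (surf R d)).
- exact: measurable_GammaD.
- exact: mpieced.
- exact: mpieced.
- apply: (@filterS _ _ (ae_filter_ringOfSetsType (surf R d))) fg => x fgx Gx /=; congr (_%:E).
  by case: (adj_elt Th x) => // i; exact: fgx.
Qed.

(* The normal is a unit vector only almost everywhere on the boundary; this
   version of it is bounded everywhere. *)
Definition unit_normal (x : E) : E :=
  if dot (normal G x) (normal G x) == 1 then normal G x else 0.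

Lemma enorm_unit_normal x : enorm (unit_normal x) <= 1.
Proof.
rewrite /unit_normal; case: eqP => [n1|_]; first by rewrite /enorm n1 sqrtr1.
by rewrite /enorm /dot big1 ?sqrtr0 ?ler01// => i _; rewrite mxE mul0r.
Qed.

Lemma ae_unit_normal :
  {ae surf R d, forall x, GammaD G x -> normal G x = unit_normal x}.
Proof.
apply: (@filterS _ _ (ae_filter_ringOfSetsType (surf R d))) (normal_outer G) => x nx Gx.
have [n1 _] := nx (GammaD_sub_bd Gx).
by rewrite /unit_normal -enorm_sqr n1 expr1n eqxx.
Qed.

Lemma measurable_normal_elt (i : 'I_(nelt Th)) b :
  measurable_fun (GammaD G `&` elt i : set (surface_type R d)) (fun x => normal G x 0 b).
Proof.
apply: (@measurable_funS _ _ (surface_type R d) (measurableTypeR R) (bd (Omega G))).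
- apply: borel_measurable_surface; apply: borel_closed.
  apply: closedI; first exact: closed_closure.
  by apply: open_closedC; exact: open_interior.
- by move=> x [/GammaD_sub_bd].
- exact: measurable_normal.
Qed.

Lemma measurable_unit_normal (i : 'I_(nelt Th)) b :
  measurable_fun (GammaD G `&` elt i : set (surface_type R d))
    (fun x => unit_normal x 0 b).
Proof.
have -> : (fun x => unit_normal x 0 b) = (fun x =>
    if dot (normal G x) (normal G x) == 1 then normal G x 0 b else 0).
  by apply/funext => x; rewrite /unit_normal; case: ifP => // _; rewrite mxE.
have mdot : measurable_fun (GammaD G `&` elt i : set (surface_type R d))
    (fun x => dot (normal G x) (normal G x) == 1).
  apply: measurable_fun_eqr; last exact: measurable_cst.
  by apply: measurable_sum => a; apply: measurable_funM; exact: measurable_normal_elt.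
have mG := measurable_GammaD_elt i.
apply: (@measurable_fun_if _ _ (surface_type R d) (measurableTypeR R)).
- exact: mG.
- exact: mdot.
- apply: (@measurable_funS _ _ (surface_type R d) (measurableTypeR R) _ _ _ mG).
    exact: subIsetl.
  exact: measurable_normal_elt.
- exact: measurable_cst.
Qed.

Lemma poly_D_ i a b : poly_fun k (fun x => D_ v i x a b).
Proof.
have -> : (fun x => D_ v i x a b) = fun x =>
    2^-1 * (partial b (fun y => v i y 0 a) x + partial a (fun y => v i y 0 b) x).
  by apply/funext => x; rewrite /D_ /symgrad /sym_part !mxE.
by apply: poly_funZ; apply: poly_funD; exact: poly_fun_partial.
Qed.

Lemma sym_D_ i x : sym_mx (D_ v i x).
Proof. exact: sym_part_sym. Qed.

Lemma bmeas_poly (i : 'I_(nelt Th)) (q : E -> R) :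
  poly_fun k q -> bmeas (elt i : set (borel R d)) q.
Proof.
move=> kq; split; first by apply: poly_fun_measurable kq; exact: closed_elt.
have [M EM] := bounded_elt Th; have [B qB] := poly_fun_bounded M kq.
by exists B => x /EM /qB.
Qed.

Lemma bmeas_fnorm2 : bmeas_Omega (fun i x => fnorm (D_ v i x) ^+ 2).
Proof.
move=> i; under eq_fun do rewrite fnorm_sqrE.
apply: bmeas_sum => a; apply: bmeas_sum => b; apply: bmeasX.
by apply: bmeas_poly; exact: poly_D_.
Qed.

Lemma bmeas_enorm2 : bmeas_Omega (fun i x => enorm (v i x) ^+ 2).
Proof.
move=> i; under eq_fun do rewrite enorm_sqr.
by apply: bmeas_sum => a; apply: bmeasM; exact: bmeas_poly.
Qed.

Lemma bmeas_hsize_fnorm2 : bmeas_Omega (fun i x => hsize i * fnorm (D_ v i x) ^+ 2).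
Proof. by move=> i; apply: bmeasM; [exact: bmeas_cst|exact: bmeas_fnorm2]. Qed.

Lemma bmeas_hsizeV_enorm2 : bmeas_Omega (fun i x => (hsize i)^-1 * enorm (v i x) ^+ 2).
Proof. by move=> i; apply: bmeasM; [exact: bmeas_cst|exact: bmeas_enorm2]. Qed.

Lemma trace_D_ (c : R) : discrete_trace Th k c ->
  int_GammaD (fun i x => hsize i * fnorm (D_ v i x) ^+ 2) <= (1 + `|c|) * normD2 v.
Proof.
move=> tr; rewrite /normD2 int_Omega_sum//; last exact: bmeas_fnorm2.
rewrite [leLHS](int_GammaD_sum d_gt0 (bmeas_Omega_GammaD bmeas_hsize_fnorm2)).
rewrite mulr_sumr; apply: ler_sum => i _.
have Gfin : (surf R d (GammaD G `&` elt i) < +oo)%E.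
  by apply: le_lt_trans (surf_GammaD_fin d_gt0 G); exact: (le_hausdorff d.-1 (@subIsetl _ _ _)).
have mG := measurable_GammaD_elt i.
have bm := bmeas_Omega_GammaD bmeas_fnorm2 i.
(* The trace inequality concerns the whole part of GammaD in the element, which contains the
   selected piece. *)
apply: (@le_trans _ _ (\int[surf R d]_(x in GammaD G `&` elt i)
    (hsize i * fnorm (D_ v i x) ^+ 2))).
  apply: (@bmeas_Rintegral_subset _ (surface_type R d) R (surf R d)).
  - exact: measurable_adj_piece.
  - exact: mG.
  - exact: Gfin.
  - exact: adj_piece_sub.
  - exact: bmeas_Omega_GammaD bmeas_hsize_fnorm2 i.
  - by move=> x _; rewrite mulr_ge0 ?sqr_ge0// ltW// hsize_gt0.
rewrite (@RintegralZl _ (surface_type R d) R (surf R d) _ _ _ mG); last first.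
  exact: (bmeas_integrable mG Gfin bm).
have bmS a b : bmeas (elt i : set (borel R d)) (fun x => D_ v i x a b ^+ 2).
  by apply: bmeasX; apply: bmeas_poly; exact: poly_D_.
have bmG a b : bmeas (GammaD G `&` elt i : set (surface_type R d))
    (fun x => D_ v i x a b ^+ 2).
  by apply: (@bmeas_Omega_GammaD _ _ _ Th (fun i x => D_ v i x a b ^+ 2)) => j;
     apply: bmeasX; apply: bmeas_poly; exact: poly_D_.
have bmI a b : bmeas ((elt i)° : set (borel R d)) (fun x => D_ v i x a b ^+ 2).
  by apply: bmeasS (bmS a b); [exact: measurable_elt|exact: interior_subset].
have -> : \int[surf R d]_(x in GammaD G `&` elt i) (fnorm (D_ v i x) ^+ 2) =
    \sum_a \sum_b \int[surf R d]_(x in GammaD G `&` elt i) (D_ v i x a b ^+ 2).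
  under eq_Rintegral do rewrite fnorm_sqrE.
  rewrite (@bmeas_Rintegral_sum _ (surface_type R d) R (surf R d) _ _ _ _ mG Gfin).
    apply: eq_bigr => a _.
    exact: (@bmeas_Rintegral_sum _ (surface_type R d) R (surf R d) _ _ _ _ mG Gfin).
  by move=> a; apply: bmeas_sum => b; exact: bmG.
have -> : \int[leb R d]_(x in (elt i)°) (fnorm (D_ v i x) ^+ 2) =
    \sum_a \sum_b \int[leb R d]_(x in (elt i)°) (D_ v i x a b ^+ 2).
  under eq_Rintegral do rewrite fnorm_sqrE.
  have mi := measurable_elt_interior i; have fi := leb_elt_fin i.
  rewrite (@bmeas_Rintegral_sum _ (borel R d) R (leb R d) _ _ _ _ mi fi).
    apply: eq_bigr => a _.
    exact: (@bmeas_Rintegral_sum _ (borel R d) R (leb R d) _ _ _ _ mi fi).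
  by move=> a; apply: bmeas_sum => b; exact: bmI.
rewrite !mulr_sumr; apply: ler_sum => a _; rewrite !mulr_sumr; apply: ler_sum => b _.
apply: (le_trans (tr i _ (poly_D_ i a b))); apply: ler_wpM2r.
  by apply: Rintegral_ge0 => x _; exact: sqr_ge0.
by rewrite (le_trans (ler_norm c))// lerDr.
Qed.

End Traces.

(** * Coercivity *)

Section Coercivity.
Variables (R : realType) (d : nat) (d_gt0 : (0 < d)%N) (G : domain R d) (Th : mesh G).
Variables (nu_inf nu delta p : R).
Hypotheses (nu_inf0 : 0 < nu_inf) (nu0 : 0 < nu) (delta0 : 0 < delta)
  (p12 : 1 < p < 2).
Variables (gD ghat : 'rV[R]_d -> 'rV[R]_d) (Dg : field Th 'M[R]_d).
Hypothesis lift_g : lifting gD ghat Dg.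
Variables (T : field Th ('M[R]_d -> 'M[R]_d)) (eta_bar : R).
Hypotheses (Tfield : tangent_field T)
  (Tbounds : tangent_bounds nu_inf nu delta p T Dg eta_bar).
Variables (k : nat) (v : field Th 'rV[R]_d) (c : R).
Hypotheses (v_poly : forall i j, poly_fun k (fun x => v i x 0 j))
  (trace_c : discrete_trace Th k c).
Local Notation E := 'rV[R]_d.
Local Notation elt := (@elt R d G Th).
Local Notation eta := (eta nu_inf nu delta p).
Local Notation DS := (DS nu_inf nu delta p).

Let B i x := D_ v i x.

Let symB i x : sym_mx (B i x). Proof. exact: sym_D_. Qed.

Let bounds i x : elt i x ->
  nu_inf * fnorm (B i x) ^+ 2 <= frob (T i x (B i x)) (B i x) /\
  fnorm (T i x (B i x)) + fnorm (DS (Dg i x) (B i x)) <= eta_bar * fnorm (B i x).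
Proof. by move=> xi; exact: (tangent_bounds_elt delta0 lift_g Tfield Tbounds xi (symB i x)). Qed.

Let measurable_B i a b : measurable_fun (elt i : set (borel R d)) (fun x => B i x a b).
Proof. by have [] := bmeas_poly i (poly_D_ v_poly i a b). Qed.

Let measurable_v i a : measurable_fun (elt i : set (borel R d)) (fun x => v i x 0 a).
Proof. by have [] := bmeas_poly i (v_poly i a). Qed.

Let bmeas_volume : bmeas_Omega (fun i x => frob (T i x (B i x)) (B i x)).
Proof.
move=> i; apply: (@bmeas_le _ (borel R d) R _ _ (fun x => eta_bar * fnorm (B i x) ^+ 2)).
- apply: measurable_sum => a; apply: measurable_sum => b; apply: measurable_funM => //.
  exact: (measurable_tangent Tfield).
- by apply: bmeasM; [exact: bmeas_cst|exact: bmeas_fnorm2].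
move=> x xi; rewrite (le_trans (normr_frob _ _))// expr2 mulrA.
rewrite ler_wpM2r ?fnorm_ge0//; apply: le_trans (bounds xi).2.
by rewrite lerDl fnorm_ge0.
Qed.

Lemma volume_coercive :
  nu_inf * normD2 v <= int_Omega (fun i x => frob (T i x (B i x)) (B i x)).
Proof.
have bm := bmeas_fnorm2 v_poly.
rewrite /normD2 -int_OmegaZ//; apply: le_int_Omega => //.
- by move=> i; apply: bmeasM; [exact: bmeas_cst|exact: bm].
- by move=> i x /bounds[].
Qed.

Let surface_measurable i (f : E -> R) : measurable_fun (elt i : set (borel R d)) f ->
  measurable_fun (GammaD G `&` elt i : set (surface_type R d)) f.
Proof.
move=> mf; apply: (@measurable_funS _ _ (surface_type R d) (measurableTypeR R) (elt i)).
- by apply: borel_measurable_surface; exact: measurable_elt.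
- exact: subIsetr.
- by apply: measurable_fun_surface => //; exact: measurable_elt.
Qed.

(** The normal is a parameter: measurability is needed for both [normal G] and [unit_normal G],
    boundedness is obtained for the latter. *)
Let flux (n : E -> E) : field Th R :=
  fun i x => dot (mxv (T i x (B i x)) (n x)) (v i x).
Let adjoint_flux (n : E -> E) : field Th R :=
  fun i x => dot (v i x) (mxv (DS (Dg i x) (B i x)) (n x)).

Let measurable_mxv i (A : E -> 'M[R]_d) (n : E -> E) a :
  (forall a b, measurable_fun (elt i : set (borel R d)) (fun x => A x a b)) ->
  (forall b, measurable_fun (GammaD G `&` elt i : set (surface_type R d))
    (fun x => n x 0 b)) ->
  measurable_fun (GammaD G `&` elt i : set (surface_type R d))
    (fun x => mxv (A x) (n x) 0 a).
Proof.
move=> mA mn; rewrite /mxv; under eq_fun do rewrite mxE.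
apply: measurable_sum => b; apply: measurable_funM; first exact: mn.
by under eq_fun do rewrite mxE; exact: (surface_measurable (mA a b)).
Qed.

Let measurable_flux (n : E -> E) : (forall (i : 'I_(nelt Th)) b, measurable_fun
    (GammaD G `&` elt i : set (surface_type R d)) (fun x => n x 0 b)) ->
  measurable_GammaD_field (flux n).
Proof.
move=> mn i; apply: measurable_sum => a; apply: measurable_funM.
  apply: (measurable_mxv (A := fun x => T i x (B i x))); last exact: mn.
  by move=> a' b; exact: (measurable_tangent Tfield).
exact: (surface_measurable (@measurable_v i a)).
Qed.

Let measurable_adjoint_flux (n : E -> E) : (forall (i : 'I_(nelt Th)) b, measurable_fun
    (GammaD G `&` elt i : set (surface_type R d)) (fun x => n x 0 b)) ->
  measurable_GammaD_field (adjoint_flux n).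
Proof.
move=> mn i; apply: measurable_sum => a; apply: measurable_funM.
  exact: (surface_measurable (@measurable_v i a)).
apply: (measurable_mxv (A := fun x => DS (Dg i x) (B i x))); last exact: mn.
by move=> a' b; exact: (measurable_DS nu_inf nu p delta0 lift_g).
Qed.

(** [alpha] is chosen so that alpha ct = nu_inf / 2, and [beta] so that 4 alpha beta = eta_bar^2, as
    Young's inequality requires. *)
Let ct := 1 + `|c|.
Let alpha := nu_inf / (2 * ct).
Let beta := eta_bar ^+ 2 * ct / (2 * nu_inf).
Let young : field Th R := fun i x =>
  alpha * (hsize i * fnorm (B i x) ^+ 2) + beta * ((hsize i)^-1 * enorm (v i x) ^+ 2).

Let ct_gt0 : 0 < ct. Proof. by rewrite ltr_pwDl. Qed.

Let young_le i x : eta_bar * fnorm (B i x) * enorm (v i x) <= young i x.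
Proof.
have h0 := hsize_gt0 d_gt0 i.
rewrite /young; set h := hsize i in h0 *.
set b := fnorm _; set w := enorm _.
(* Because 4 alpha beta = eta_bar^2, the difference of the two sides is a perfect square. *)
have -> : alpha * (h * b ^+ 2) + beta * (h^-1 * w ^+ 2) = eta_bar * b * w +
    (nu_inf * h * b - eta_bar * ct * w) ^+ 2 / (2 * ct * nu_inf * h).
  rewrite /alpha /beta; field.
  by rewrite !gt_eqF.
by rewrite lerDl divr_ge0 ?sqr_ge0// !mulr_ge0// ltW.
Qed.

Let fluxes_le i x : elt i x ->
  `|flux (unit_normal G) i x| + `|adjoint_flux (unit_normal G) i x| <= young i x.
Proof.
move=> xi; apply: le_trans (young_le i x).
have n1 := enorm_unit_normal G x; have v0 := enorm_ge0 (v i x).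
have key A : `|dot (mxv A (unit_normal G x)) (v i x)| <= fnorm A * enorm (v i x).
  rewrite (le_trans (normr_dot_mxv _ _ _))// ler_wpM2r//.
  by rewrite ler_piMr// fnorm_ge0.
rewrite /flux /adjoint_flux [dot (v i x) _]dotC.
apply: (le_trans (lerD (key _) (key _))).
by rewrite -mulrDl ler_wpM2r// (bounds xi).2.
Qed.

Let bmeas_young : bmeas_GammaD young.
Proof.
apply: bmeas_Omega_GammaD => i; apply: bmeasD; apply: bmeasM.
- exact: bmeas_cst.
- exact: (bmeas_hsize_fnorm2 v_poly).
- exact: bmeas_cst.
- exact: (bmeas_hsizeV_enorm2 v_poly).
Qed.

Let bmeas_flux : bmeas_GammaD (flux (unit_normal G)).
Proof.
move=> i; apply: (@bmeas_le _ (surface_type R d) R _ _ (young i)).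
- by apply: measurable_flux; exact: measurable_unit_normal.
- exact: bmeas_young.
by move=> x [_ xi]; apply: le_trans (fluxes_le xi); rewrite lerDl.
Qed.

Let bmeas_adjoint_flux : bmeas_GammaD (adjoint_flux (unit_normal G)).
Proof.
move=> i; apply: (@bmeas_le _ (surface_type R d) R _ _ (young i)).
- by apply: measurable_adjoint_flux; exact: measurable_unit_normal.
- exact: bmeas_young.
by move=> x [_ xi]; apply: le_trans (fluxes_le xi); rewrite lerDr.
Qed.

Lemma consistency_terms_le :
  int_GammaD (fun i x => dot (mxv (T i x (D_ v i x)) (normal G x)) (v i x))
  + int_GammaD (fun i x => dot (v i x) (mxv (DS (Dg i x) (D_ v i x)) (normal G x)))
  <= nu_inf / 2 * normD2 v
     + eta_bar ^+ 2 * (1 + `|c|) / (2 * nu_inf) * normG2 v.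
Proof.
(* The normal is changed on a null set before the two integrals are merged, because integrability is
   established for the bounded normal. *)
have -> : int_GammaD (fun i x => dot (mxv (T i x (D_ v i x)) (normal G x)) (v i x)) =
    int_GammaD (flux (unit_normal G)).
  apply: ae_eq_int_GammaD.
  - by apply: measurable_flux; exact: measurable_normal_elt.
  - by apply: measurable_flux; exact: measurable_unit_normal.
  apply: (@filterS _ _ (ae_filter_ringOfSetsType (surf R d))) (ae_unit_normal G).
  by move=> x nx Gx i; rewrite /flux -nx.
have -> : int_GammaD (fun i x => dot (v i x) (mxv (DS (Dg i x) (D_ v i x)) (normal G x))) =
    int_GammaD (adjoint_flux (unit_normal G)).
  apply: ae_eq_int_GammaD.
  - by apply: measurable_adjoint_flux; exact: measurable_normal_elt.
  - by apply: measurable_adjoint_flux; exact: measurable_unit_normal.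
  apply: (@filterS _ _ (ae_filter_ringOfSetsType (surf R d))) (ae_unit_normal G).
  by move=> x nx Gx i; rewrite /adjoint_flux -nx.
rewrite -(int_GammaDD d_gt0 bmeas_flux bmeas_adjoint_flux).
apply: (@le_trans _ _ (int_GammaD young)).
  apply: (le_int_GammaD d_gt0).
  - by move=> i; apply: bmeasD; [exact: bmeas_flux|exact: bmeas_adjoint_flux].
  - exact: bmeas_young.
  move=> i x _ xi; apply: le_trans (fluxes_le xi).
  by apply: lerD; exact: ler_norm.
have bm1 := bmeas_Omega_GammaD (bmeas_hsize_fnorm2 v_poly).
have bm2 := bmeas_Omega_GammaD (bmeas_hsizeV_enorm2 v_poly).
have bm1' : bmeas_GammaD (fun i x => alpha * (hsize i * fnorm (B i x) ^+ 2)).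
  by move=> i; apply: bmeasM; [exact: bmeas_cst|exact: bm1].
have bm2' : bmeas_GammaD (fun i x => beta * ((hsize i)^-1 * enorm (v i x) ^+ 2)).
  by move=> i; apply: bmeasM; [exact: bmeas_cst|exact: bm2].
rewrite /young (int_GammaDD d_gt0 bm1' bm2').
rewrite (int_GammaDZ d_gt0 alpha bm1) (int_GammaDZ d_gt0 beta bm2) lerD2r.
have a0 : 0 <= alpha by rewrite divr_ge0 ?(ltW nu_inf0)// mulr_ge0// ltW.
apply: (le_trans (ler_wpM2l a0 (trace_D_ d_gt0 v_poly trace_c))).
rewrite -/ct mulrA; suff -> : alpha * ct = nu_inf / 2 by [].
by rewrite /alpha; field; rewrite gt_eqF.
Qed.

Lemma penalty_ge : nu_inf * normG2 v <=
  int_GammaD (fun i x => (hsize i)^-1 * eta (Dg i x) * dot (v i x) (v i x)).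
Proof.
have bm := bmeas_Omega_GammaD (bmeas_hsizeV_enorm2 v_poly).
(* The upper bound on the viscosity ensures that the penalty integrand is integrable. *)
have [M etaM] := eta_bounded d nu_inf0 nu0 delta0 p12.
rewrite /normG2 -(int_GammaDZ d_gt0 _ bm); apply: (le_int_GammaD d_gt0).
- by move=> i; apply: bmeasM; [exact: bmeas_cst|exact: bm].
- apply: bmeas_Omega_GammaD => i; apply: bmeasM.
    apply: bmeasM; first exact: bmeas_cst.
    split; first exact: (measurable_eta _ _ _ delta0 lift_g).
    by exists M => x _; exact: etaM.
  have := bmeas_enorm2 v_poly i; under eq_fun do rewrite enorm_sqr.
  by [].
- move=> i x _ _; rewrite -enorm_sqr mulrCA -mulrA.
  rewrite ler_wpM2l ?invr_ge0 ?(ltW (hsize_gt0 d_gt0 i))// ler_wpM2r ?sqr_ge0//.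
  exact: eta_ge.
Qed.

Lemma a_form_ge gamma1 gamma2 : 0 < gamma1 ->
  nu_inf / 2 * normD2 v
  + (gamma1 * nu_inf - eta_bar ^+ 2 * (1 + `|c|) / (2 * nu_inf)) * normG2 v
  + gamma2 * normGn2 v <= a_form nu_inf nu delta p T Dg gamma1 gamma2 v v.
Proof.
move=> g1; have := volume_coercive; have := consistency_terms_le.
have : gamma1 * (nu_inf * normG2 v) <= gamma1 * int_GammaD (fun i x =>
    (hsize i)^-1 * eta (Dg i x) * dot (v i x) (v i x)).
  by rewrite ler_wpM2l ?(ltW g1)// penalty_ge.
rewrite /a_form.
have -> : int_GammaD (fun i x =>
    (hsize i)^-1 * dot (v i x) (normal G x) * dot (v i x) (normal G x)) = normGn2 v.
  by apply: eq_int_GammaD => i x _ _; rewrite expr2 mulrA.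
rewrite mulrBl mulrA.
set b := _ / (2 * nu_inf) * normG2 v.
lra.
Qed.

End Coercivity.

(** * Signs of the squared norms *)

Section Nonnegative.
Variables (R : realType) (d : nat) (d_gt0 : (0 < d)%N) (G : domain R d) (Th : mesh G).
Variable v : field Th 'rV[R]_d.

Let int_GammaD_ge0 (f : field Th R) : (forall i x, 0 <= f i x) -> 0 <= int_GammaD f.
Proof. by move=> f0; apply: Rintegral_ge0 => x _; case: (adj_elt Th x). Qed.

Lemma normD2_ge0 : 0 <= normD2 v.
Proof.
by apply: Rintegral_ge0 => x _; case: (elt_at Th x) => // i; exact: sqr_ge0.
Qed.

Lemma normG2_ge0 : 0 <= normG2 v.
Proof.
apply: int_GammaD_ge0 => i x.
by rewrite mulr_ge0 ?sqr_ge0// invr_ge0 ltW// hsize_gt0.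
Qed.

Lemma normGn2_ge0 : 0 <= normGn2 v.
Proof.
apply: int_GammaD_ge0 => i x.
by rewrite mulr_ge0 ?sqr_ge0// invr_ge0 ltW// hsize_gt0.
Qed.

End Nonnegative.
Theorem corollary4p1 (R : realType) (d k : nat) (hd : d = 2%N \/ d = 3%N)
    (c_trace c_korn : R -> R) :
  exists c : R -> R -> R,
  (forall kappa r, 0 < c kappa r) /\
  forall (G : domain R d) (Th : mesh G) (P : fe_pair Th k) (kappa : R)
    (nu_inf nu delta p : R)
    (gD ghat : 'rV[R]_d -> 'rV[R]_d) (Dg : field Th 'M[R]_d)
    (U : field Th 'rV[R]_d * field Th R),
  shape_regular Th kappa ->
  discrete_trace Th k (c_trace kappa) ->
  discrete_korn P (c_korn kappa) ->
  0 < nu_inf -> 0 < nu -> 0 < delta -> 1 < p < 2 ->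
  lifting gD ghat Dg ->
  Vh P U.1 -> Qh P U.2 ->
  [/\ forall (T : field Th ('M[R]_d -> 'M[R]_d)) (eta_bar : R),
        tangent_field T ->
        nu_inf <= eta_bar ->
        tangent_bounds nu_inf nu delta p T Dg eta_bar ->
        let C_tr := nu_inf * c kappa (eta_bar / nu_inf) in
        forall gamma1 gamma2, 0 < gamma1 -> 0 < gamma2 ->
        let a := a_form nu_inf nu delta p T Dg gamma1 gamma2 in
        (forall v, Vh P v ->
           nu_inf / 2 * normD2 v + (gamma1 * nu_inf - C_tr) * normG2 v
           + gamma2 * normGn2 v <= a v v) /\
        (2 * C_tr / nu_inf <= gamma1 -> coercive (Vh P) a),
      forall (gD' ghat' : 'rV[R]_d -> 'rV[R]_d) (Dg' : field Th 'M[R]_d),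
        lifting gD' ghat' Dg' ->
        (forall i x, GammaD G x -> elt i x ->
           eta nu_inf nu delta p (Dg' i x) = eta nu_inf nu delta p (Dg i x) /\
           forall B : 'M[R]_d, sym_mx B ->
             DS nu_inf nu delta p (Dg' i x) B = DS nu_inf nu delta p (Dg i x) B) ->
        forall T gamma1 gamma2 v z, Vh P v -> Vh P z ->
          a_form nu_inf nu delta p T Dg' gamma1 gamma2 v z =
          a_form nu_inf nu delta p T Dg gamma1 gamma2 v z &
      let A := D_ U.1 in
      let bounded_tangent T := exists2 eta_bar, nu_inf <= eta_bar &
        tangent_bounds nu_inf nu delta p T Dg eta_bar in
      [/\ bounded_tangent (fun i x => T_Pic nu_inf nu delta p (A i x)),
          bounded_tangent (fun i x => T_exN nu_inf nu delta p (A i x)) &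
          forall sigma_max, 0 < sigma_max ->
            bounded_tangent
              (fun i x => T_modN nu_inf nu delta p sigma_max (A i x))]].
Proof.
have d_gt0 : (0 < d)%N by case: hd => ->.
have c_gt0 (t r : R) : 0 < (1 + `|t|) * ((r ^+ 2 + 1) / 2).
  have r1 : 0 < r ^+ 2 + 1 by rewrite ltr_wpDl ?sqr_ge0.
  by rewrite mulr_gt0 ?divr_gt0// ltr_pwDl.
(* With r = eta_bar / nu_inf, the r^2 part times nu_inf is the boundary constant from Young's
   inequality; the added 1 keeps the value positive also at r = 0. *)
exists (fun kappa r => (1 + `|c_trace kappa|) * ((r ^+ 2 + 1) / 2)); split.
  by move=> kappa r; exact: c_gt0.
move=> G Th P kappa nu_inf nu delta p gD ghat Dg U _ trace_c _ nu_inf0 nu0 delta0 p12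
  lift_g _ _; split; last exact: three_tangents_bounded.
  move=> T eta_bar Tfield eta_ge_nu Tbounds C_tr gamma1 gamma2 g1 g2 a.
  have Ctr_ge : eta_bar ^+ 2 * (1 + `|c_trace kappa|) / (2 * nu_inf) <= C_tr.
    have -> : C_tr = eta_bar ^+ 2 * (1 + `|c_trace kappa|) / (2 * nu_inf)
        + nu_inf * (1 + `|c_trace kappa|) / 2.
      by rewrite /C_tr; field; rewrite gt_eqF.
    by rewrite lerDl divr_ge0// mulr_ge0 ?addr_ge0// ltW.
  have main v : Vh P v -> nu_inf / 2 * normD2 v + (gamma1 * nu_inf - C_tr) * normG2 v
      + gamma2 * normGn2 v <= a v v.
    move=> Vv; have v_poly := Vh_poly Vv.
    have := a_form_ge d_gt0 nu_inf0 nu0 delta0 p12 lift_g Tfield Tbounds v_poly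
      trace_c gamma2 g1.
    apply: le_trans; rewrite lerD2r lerD2l ler_wpM2r ?normG2_ge0//.
    by rewrite lerD2l lerN2.
  split=> // gamma1_ge.
  have Ctr0 : 0 < C_tr by exact: mulr_gt0.
  have nu20 : 0 < nu_inf / 2 by rewrite divr_gt0.
  (* The threshold on gamma1 leaves gamma1 nu_inf - C_tr >= C_tr, and the normal penalty is
     nonnegative. *)
  exists (Num.min (nu_inf / 2) C_tr); first by rewrite lt_min nu20.
  move=> v Vv; apply: le_trans (main v Vv).
  have D0 := normD2_ge0 v; have G0 := normG2_ge0 d_gt0 v.
  have Gn0 := normGn2_ge0 d_gt0 v.
  have gC : C_tr <= gamma1 * nu_inf - C_tr.
    by move: gamma1_ge; rewrite ler_pdivrMr//; lra.
  rewrite mulrDr; apply: (@le_trans _ _ (nu_inf / 2 * normD2 v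
      + (gamma1 * nu_inf - C_tr) * normG2 v)).
    by apply: lerD; rewrite ler_wpM2r// ge_min ?lexx// gC orbT.
  by rewrite lerDl mulr_ge0// ltW.
move=> gD' ghat' Dg' _ same T gamma1 gamma2 v z _ _; rewrite /a_form.
(* [Dg] enters two boundary terms, where [DS] is evaluated at symmetric gradients; agreement of the
   coefficients on GammaD therefore suffices. *)
have -> : int_GammaD (fun i x =>
      dot (v i x) (mxv (DS nu_inf nu delta p (Dg' i x) (D_ z i x)) (normal G x))) =
    int_GammaD (fun i x =>
      dot (v i x) (mxv (DS nu_inf nu delta p (Dg i x) (D_ z i x)) (normal G x))).
  apply: eq_int_GammaD => i x Gx xi.
  by rewrite ((same i x Gx xi).2 _ (sym_D_ z i x)).
suff -> : int_GammaD (fun i x =>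
      (hsize i)^-1 * eta nu_inf nu delta p (Dg' i x) * dot (v i x) (z i x)) =
    int_GammaD (fun i x =>
      (hsize i)^-1 * eta nu_inf nu delta p (Dg i x) * dot (v i x) (z i x)) by [].
by apply: eq_int_GammaD => i x Gx xi; rewrite (same i x Gx xi).1.
Qed.
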